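(* Let $\mathbf{A}<_M\mathbf{B}$ be Medvedev degrees. Then either the interval $[\mathbf{A},\mathbf{B}]$ is isomorphic to the Boolean algebra $\mathfrak{2}^n$ for some $n\geq1$, or $[\mathbf{A},\mathbf{B}]$ contains an antichain of cardinality $2^{2^{\aleph_0}}$. In the latter case, assuming the Continuum Hypothesis, $[\mathbf{A},\mathbf{B}]$ also contains a chain of cardinality $2^{2^{\aleph_0}}$.
   Context: A mass problem is a subset of $\omega^\omega$. $\mathcal{A}\leq_M\mathcal{B}$ means there is a partial computable functional $\Psi$ defined on all of $\mathcal{B}$ with $\Psi(\mathcal{B})\subseteq\mathcal{A}$; Medvedev degrees are the $\equiv_M$-equivalence classes of mass problems, ordered by the induced order. $[\mathbf{A},\mathbf{B}]=\{\mathbf{C}:\mathbf{A}\leq_M\mathbf{C}\leq_M\mathbf{B}\}$. An antichain is a set of pairwise incomparable elements; a chain is a set linearly ordered by $<_M$. $\mathfrak{2}^n$ is the Boolean algebra of all subsets of $\{0,\ldots,n-1\}$ under inclusion. *)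

(* Defs.v *)
From HB Require Import structures.
From mathcomp Require Import all_boot all_order.
From mathcomp Require Import boolp classical_sets functions cardinality.

Set Implicit Arguments.
Unset Strict Implicit.
Unset Printing Implicit Defensive.

Import Order.TTheory.

Local Open Scope classical_set_scope.
Local Open Scope quotient_scope.
Local Open Scope card_scope.

(* Kleene's mu-recursive functions relative to an oracle.  A code denotes a
   partial function on finite argument lists: [CPrec] recurses on the head of
   the list, [CMu] minimises over a new head. *)
Inductive code : Type :=
| CZero
| CSucc
| CProj of nat
| COracle
| CComp of code & seq code
| CPrec of code & code
| CMu of code.

(* [eval f c xs y]: with oracle f, the computation c on input xs halts with
   output y. *)
Inductive eval (f : nat -> nat) : code -> seq nat -> nat -> Prop :=
| EvZero xs : eval f CZero xs 0
| EvSucc x xs : eval f CSucc (x :: xs) x.+1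
| EvProj i xs : i < size xs -> eval f (CProj i) xs (nth 0 xs i)
| EvOracle x xs : eval f COracle (x :: xs) (f x)
| EvComp c cs xs ys z :
    size ys = size cs ->
    (forall i, i < size cs -> eval f (nth CZero cs i) xs (nth 0 ys i)) ->
    eval f c ys z -> eval f (CComp c cs) xs z
| EvPrec0 c d xs y : eval f c xs y -> eval f (CPrec c d) (0 :: xs) y
| EvPrecS c d n xs y z :
    eval f (CPrec c d) (n :: xs) y -> eval f d [:: n, y & xs] z ->
    eval f (CPrec c d) (n.+1 :: xs) z
| EvMu c xs n (k : nat -> nat) :
    (forall i, i < n -> eval f c (i :: xs) (k i).+1) ->
    eval f c (n :: xs) 0 -> eval f (CMu c) xs n.

Lemma eval_det f c xs y y' : eval f c xs y -> eval f c xs y' -> y = y'.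
Proof.
move=> H; elim: H y' => {c xs y}.
- by move=> xs y' H; inversion H.
- by move=> x xs y' H; inversion H.
- by move=> i xs _ y' H; inversion H.
- by move=> x xs y' H; inversion H.
- move=> c cs xs ys z szs _ IHcs _ IHc y' H.
  inversion H as [| | | |c0 cs0 xs0 ys' z0 szs' Hcs' Hc'| | |]; subst.
  suff E : ys = ys' by apply: IHc; rewrite E.
  apply: (@eq_from_nth _ 0); first by rewrite szs szs'.
  by move=> i; rewrite szs => lti; apply: IHcs => //; apply: Hcs'.
- by move=> c d xs y _ IH y' H; inversion H; subst; apply: IH.
- move=> c d n xs y z _ IHy _ IHz y' H.
  inversion H as [| | | | | |c0 d0 n0 xs0 y1 z0 H1 H2|]; subst.
  by apply: IHz; rewrite (IHy _ H1).
- move=> c xs n k _ IHk _ IH0 y' H.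
  inversion H as [| | | | | | |c0 xs0 n0 k' Hk' H0']; subst.
  case: (ltngtP n y') => // lt.
    by have := IH0 _ (Hk' _ lt).
  by have := IHk _ lt _ H0'.
Qed.

Definition baire := nat -> nat.

Definition mass_problem := set baire.

(* The graph of the partial computable functional with code c. *)
Definition Phi (c : code) (f g : baire) : Prop :=
  forall n, eval f c [:: n] (g n).

Definition Phi_dom (c : code) : set baire := [set f | exists g, Phi c f g].

Definition Phi_image (c : code) (B : set baire) : set baire :=
  [set g | exists2 f, B f & Phi c f g].

Definition medvedev_le (A B : mass_problem) : Prop :=
  exists c : code, B `<=` Phi_dom c /\ Phi_image c B `<=` A.

Lemma Phi_det c f g g' : Phi c f g -> Phi c f g' -> g = g'.
Proof. by move=> H H'; apply/funext => n; apply: eval_det (H n) (H' n). Qed.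

Fixpoint code_subst (d c : code) : code :=
  match c with
  | COracle => CComp d [:: CProj 0]
  | CComp c cs => CComp (code_subst d c) (map (code_subst d) cs)
  | CPrec c1 c2 => CPrec (code_subst d c1) (code_subst d c2)
  | CMu c => CMu (code_subst d c)
  | c => c
  end.

Lemma eval_subst f g d c xs y :
  Phi d f g -> eval g c xs y -> eval f (code_subst d c) xs y.
Proof.
move=> dfg; elim=> {c xs y} /=; try by move=> *; econstructor; eauto.
- move=> x xs; apply: (@EvComp _ _ _ _ [:: x]) => //.
  by case=> // _ /=; apply: (@EvProj f 0 (x :: xs)).
- move=> c cs xs ys z szs _ IHcs _ IHc.
  apply: EvComp IHc; rewrite size_map // => i lti.
  by rewrite (nth_map CZero) //; apply: IHcs.
Qed.

Lemma Phi_subst f g h c d :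
  Phi d f g -> Phi c g h -> Phi (code_subst d c) f h.
Proof. by move=> dfg cgh n; apply: eval_subst (cgh n). Qed.

Lemma medvedev_le_refl A : medvedev_le A A.
Proof.
have idP f : Phi COracle f f by move=> n; constructor.
exists COracle; split=> [f _|g [f Af fg]]; first by exists f.
by rewrite (Phi_det fg (idP f)).
Qed.

Lemma medvedev_le_trans A B C :
  medvedev_le A B -> medvedev_le B C -> medvedev_le A C.
Proof.
move=> [c [Bc cA]] [d [Cd dB]]; exists (code_subst d c).
have key f : C f -> exists2 h, A h & Phi (code_subst d c) f h.
  move=> Cf; have [g fg] := Cd _ Cf.
  have Bg : B g by apply: dB; exists f.
  have [h gh] := Bc _ Bg.
  by exists h; [apply: cA; exists g|apply: Phi_subst gh].
split=> [f /key[h _ fh]|h [f /key[h' Ah' fh'] fh]]; first by exists h.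
by rewrite (Phi_det fh fh').
Qed.

Definition medvedev_equiv (A B : mass_problem) : bool :=
  `[< medvedev_le A B /\ medvedev_le B A >].

Lemma medvedev_equiv_refl : reflexive medvedev_equiv.
Proof. by move=> A; apply/asboolP; split; apply: medvedev_le_refl. Qed.

Lemma medvedev_equiv_sym : symmetric medvedev_equiv.
Proof. by move=> A B; apply/asboolP/asboolP => -[]. Qed.

Lemma medvedev_equiv_trans : transitive medvedev_equiv.
Proof.
move=> B A C /asboolP[AB BA] /asboolP[BC CB].
by apply/asboolP; split; [apply: medvedev_le_trans BC|apply: medvedev_le_trans BA].
Qed.

Canonical medvedev_equiv_rel := EquivRel medvedev_equiv
  medvedev_equiv_refl medvedev_equiv_sym medvedev_equiv_trans.

Definition medvedev_degree := {eq_quot medvedev_equiv}.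

HB.instance Definition _ := Choice.on medvedev_degree.

Definition degree_of (A : mass_problem) : medvedev_degree :=
  \pi_({eq_quot medvedev_equiv}) A.

Definition degree_le (a b : medvedev_degree) : bool :=
  `[< exists A B : mass_problem,
        [/\ degree_of A = a, degree_of B = b & medvedev_le A B] >].

Lemma degree_ofP A B :
  degree_of A = degree_of B <-> medvedev_le A B /\ medvedev_le B A.
Proof.
split; first by move/eqmodP/asboolP.
by move=> AB; apply/eqmodP/asboolP.
Qed.

Lemma degree_of_surj a : exists A, degree_of A = a.
Proof. by exists (repr a); apply: reprK. Qed.

Lemma degree_le_of A B : degree_le (degree_of A) (degree_of B) <-> medvedev_le A B.
Proof.
split=> [/asboolP[A' [B' [/degree_ofP[_ AA'] /degree_ofP[B'B _] AB']]]|AB].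
  exact: medvedev_le_trans AA' (medvedev_le_trans AB' B'B).
by apply/asboolP; exists A, B.
Qed.

Lemma degree_le_refl : reflexive degree_le.
Proof.
move=> a; have [A <-] := degree_of_surj a.
by apply/degree_le_of; apply: medvedev_le_refl.
Qed.

Lemma degree_le_anti : antisymmetric degree_le.
Proof.
move=> a b; have [A <-] := degree_of_surj a; have [B <-] := degree_of_surj b.
by move=> /andP[/degree_le_of AB /degree_le_of BA]; apply/degree_ofP.
Qed.

Lemma degree_le_trans : transitive degree_le.
Proof.
move=> b a c; have [A <-] := degree_of_surj a; have [B <-] := degree_of_surj b.
have [C <-] := degree_of_surj c => /degree_le_of AB /degree_le_of BC.
by apply/degree_le_of; apply: medvedev_le_trans BC.
Qed.

Fact medvedev_display : Order.disp_t. Proof. exact: Order.Disp tt tt. Qed.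

HB.instance Definition _ :=
  Order.Le_isPOrder.Build medvedev_display medvedev_degree
    degree_le_refl degree_le_anti degree_le_trans.

Section OrderNotions.
Context {d : Order.disp_t} {T : porderType d}.
Local Open Scope order_scope.

Definition order_interval (a b : T) : set T := [set c | a <= c <= b].

Definition antichain (S : set T) : Prop :=
  forall x y, S x -> S y -> x <> y -> x >< y.

Definition chain (S : set T) : Prop :=
  forall x y, S x -> S y -> [\/ x < y, x = y | y < x].

(* Order isomorphism with the Boolean algebra of all subsets of 'I_n. *)
Definition isomorphic_to_powerset (n : nat) (S : set T) : Prop :=
  exists f : {set 'I_n} -> T,
    set_bij [set: {set 'I_n}] S f /\ {mono f : X Y / X \subset Y >-> X <= Y}.

End OrderNotions.

(* The power set of the power set of nat has cardinality 2^(2^aleph_0). *)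
Definition card_2_2_aleph0 {T : Type} (S : set T) : Prop :=
  S #= [set: set (set nat)].

Definition continuum_hypothesis : Prop :=
  forall S : set (set nat), countable S \/ S #= [set: set nat].

Definition contains_big_antichain (a b : medvedev_degree) : Prop :=
  exists S : set medvedev_degree,
    [/\ S `<=` order_interval a b, antichain S & card_2_2_aleph0 S].

Definition contains_big_chain (a b : medvedev_degree) : Prop :=
  exists S : set medvedev_degree,
    [/\ S `<=` order_interval a b, chain S & card_2_2_aleph0 S].

(* Main.v *)
(* Identify a degree with a mass problem and write [meet] for the greatest lower
   bound.  If [meet B F] is below [A] for a finite [F] above [A], take [F] minimal:
   either every [f] in [F] is such that all [join f g] with [g] not computable
   from [f] uniformly compute elements of [B], and then the interval is the
   Boolean algebra of the subsets of [F]; or some [f] fails this, witnessed by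
   countably many [z i].  If there is no such [F], points [h i] of [A] and numbers
   [z i] are built by diagonalisation, so that no finite set of pairs together
   with [B] is below all the pairs.  In both of the last two situations the
   problems consisting of [B], all [join (h i) (z i)] and all
   [join (h i) (tau ++ a x)], for [tau] a string and [x] in [S], where the [a x]
   are continuum many mutually generic reals, embed the power set of the
   continuum into the interval, reversing inclusion.  Chains and antichains are
   then found in this power set. *)

(* On [join (h i) (tau ++ a x)] a functional into the problem of [S] can answer with an element of
   [B], with a pair [join (h j) (z j)], or with a point carrying some [a x']. Mutual genericity
   allows only x' = x in the third case, so it remains to exclude the first two on a single input.
   No functional sends all pairs into [B], so some pair gets an answer outside [B]. With a single
   [f], a beginning [tau] of [z i] fixes this, and genericity avoids the pairs because no [z j] is
   computable from [f]. Without a finite [F] genericity does not suffice; there [z j] is a constant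
   that can be read off the answer, so an answer with a small constant can only be one of finitely
   many pairs. The Continuum Hypothesis serves only to code bounded sets of reals by single reals,
   which makes the dense set behind the chain as small as the continuum. *)
From HB Require Import structures.
Require Import Defs.
From mathcomp Require Import all_boot all_order.
From mathcomp Require Import boolp classical_sets functions cardinality.
From mathcomp Require wochoice.

Set Implicit Arguments.
Unset Strict Implicit.
Unset Printing Implicit Defensive.

Import Order.TTheory.

Local Open Scope classical_set_scope.
Local Open Scope card_scope.

(** * Countability of the codes *)

Section CodeInduction.
Variable P : code -> Prop.
Hypothesis PZero : P CZero.
Hypothesis PSucc : P CSucc.
Hypothesis PProj : forall i, P (CProj i).
Hypothesis POracle : P COracle.
Hypothesis PComp :
  forall c cs, P c -> (forall i, i < size cs -> P (nth CZero cs i)) ->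
  P (CComp c cs).
Hypothesis PPrec : forall c d, P c -> P d -> P (CPrec c d).
Hypothesis PMu : forall c, P c -> P (CMu c).

Fixpoint code_nested_ind c : P c :=
  match c with
  | CZero => PZero
  | CSucc => PSucc
  | CProj i => PProj i
  | COracle => POracle
  | CComp c cs =>
      PComp (code_nested_ind c)
        ((fix loop cs : forall i, i < size cs -> P (nth CZero cs i) :=
            match cs with
            | [::] => fun i lti => False_ind _ (notF lti)
            | c :: cs' => fun i =>
                match i with
                | 0 => fun=> code_nested_ind c
                | j.+1 => loop cs' j
                end
            end) cs)
  | CPrec c d => PPrec (code_nested_ind c) (code_nested_ind d)
  | CMu c => PMu (code_nested_ind c)
  end.
End CodeInduction.

Fixpoint tree_of_code (c : code) : GenTree.tree nat :=
  match c with
  | CZero => GenTree.Node 0 [::]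
  | CSucc => GenTree.Node 1 [::]
  | CProj i => GenTree.Leaf i
  | COracle => GenTree.Node 2 [::]
  | CComp c cs => GenTree.Node 3 (tree_of_code c :: map tree_of_code cs)
  | CPrec c d => GenTree.Node 4 [:: tree_of_code c; tree_of_code d]
  | CMu c => GenTree.Node 5 [:: tree_of_code c]
  end.

Fixpoint code_of_tree (t : GenTree.tree nat) : code :=
  match t with
  | GenTree.Leaf i => CProj i
  | GenTree.Node 0 _ => CZero
  | GenTree.Node 1 _ => CSucc
  | GenTree.Node 2 _ => COracle
  | GenTree.Node 3 (t :: ts) => CComp (code_of_tree t) (map code_of_tree ts)
  | GenTree.Node 4 [:: t; u] => CPrec (code_of_tree t) (code_of_tree u)
  | GenTree.Node _ (t :: _) => CMu (code_of_tree t)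
  | GenTree.Node _ _ => CZero
  end.

Lemma tree_of_codeK : cancel tree_of_code code_of_tree.
Proof.
elim/code_nested_ind => //= [c cs -> IHcs|c d -> ->|c ->] //.
congr CComp; rewrite -map_comp; apply: (@eq_from_nth _ CZero).
  by rewrite size_map.
by move=> i; rewrite size_map => lti; rewrite (nth_map CZero) //=; apply: IHcs.
Qed.

HB.instance Definition _ := Countable.copy code (can_type tree_of_codeK).

(** A schedule for the diagonalisation, where a requirement must return after any given stage. It
    exists since for fixed [t] the codes of the pairs [(t, k)] are unbounded. *)
Lemma inf_often_enum (T : countType) (t0 : T) :
  exists r : nat -> T, forall t m0, exists2 m, m0 <= m & r m = t.
Proof.
exists (fun m => odflt t0 (omap fst (unpickle m : option (T * nat)))) => t m0.
suff [k lek] : exists k : nat, m0 <= pickle (t, k).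
  by exists (pickle (t, k)); rewrite ?pickleK.
apply: contrapT => /forallNP nk.
have ltk (k : nat) : pickle (t, k) < m0 by rewrite ltnNge; apply/negP/nk.
have inj : injective (fun k : 'I_m0.+1 => Ordinal (ltk k)).
  by move=> i j [] /(pcan_inj pickleK) [] /val_inj.
by have := leq_card _ inj; rewrite !card_ord ltnn.
Qed.

(** * Step-bounded evaluation *)

Definition prec_iter (b : nat) (h : nat -> nat -> nat) : nat -> nat :=
  fix loop n := if n is m.+1 then h m (loop m) else b.

(* The scanning state is [0] while only nonzero values were met, [1] after an
   undefined value, and [n.+2] once the value 0 was found at [n]. *)
Definition mu_scan (v : nat -> nat) : nat -> nat :=
  prec_iter 0 (fun t st =>
    if st == 0 then (if v t == 0 then 1 else if v t == 1 then t.+2 else 0)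
    else st).

(* The result is [0] when the computation is not finished and [v.+1] when its
   value is [v].  The bound [q] limits both the unbounded searches and the
   oracle queries, so that a finished computation depends on [f] below [q]
   only. *)
Fixpoint stepf (f : baire) (q : nat) (c : code) (xs : seq nat) : nat :=
  match c with
  | CZero => 1
  | CSucc => if xs is x :: _ then x.+2 else 0
  | CProj i => if i < size xs then (nth 0 xs i).+1 else 0
  | COracle => if xs is x :: _ then (if x < q then (f x).+1 else 0) else 0
  | CComp c cs =>
      let ys := [seq stepf f q d xs | d <- cs] in
      if all (fun y => y != 0) ys then stepf f q c (map predn ys) else 0
  | CPrec c d =>
      if xs is n :: xs then
        prec_iter (stepf f q c xs)
          (fun i y => if y == 0 then 0 else stepf f q d [:: i, y.-1 & xs]) n
      else 0
  | CMu c => (mu_scan (fun t => stepf f q c (t :: xs)) q).-1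
  end.

Lemma mu_scan_found v n q :
  (forall i, i < n -> 1 < v i) -> v n = 1 -> n < q -> mu_scan v q = n.+2.
Proof.
move=> vi vn; have scan0 t : t <= n -> mu_scan v t = 0.
  elim: t => //= t IH lt; rewrite -/(mu_scan v t) IH 1?ltnW //=.
  by have := vi _ lt; case: (v t) => [|[]].
elim: q => // q IH; rewrite ltnS leq_eqVlt => /predU1P[<-|/IH] /=.
  by rewrite -/(mu_scan v n) scan0 //= vn.
by rewrite -/(mu_scan v q) => ->.
Qed.

Lemma mu_scanP v n q : mu_scan v q = n.+2 ->
  [/\ n < q, v n = 1 & forall i, i < n -> 1 < v i].
Proof.
suff H : (mu_scan v q = 0 -> forall i, i < q -> 1 < v i) /\
         (mu_scan v q = n.+2 ->
          [/\ n < q, v n = 1 & forall i, i < n -> 1 < v i]) by case: H.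
elim: q => [|q [IH0 IHn]]; first by split.
rewrite /= -/(mu_scan v q); case E: (mu_scan v q) => [|m] /=; last first.
  by split=> // Em; have [? ? ?] := IHn (etrans E Em); split=> //; apply: leqW.
have {}IH0 := IH0 E.
case Ev: (v q) => [|[|w]] //=; split=> //.
- by case=> <-; split.
- by move=> _ i; rewrite ltnS leq_eqVlt => /predU1P[->|/IH0 //]; rewrite Ev.
Qed.

(** The case [f' = f] is monotonicity in the bound; the case [q' = q] is the use principle, because
    [q] also bounds the queries. *)
Lemma stepf_mono f f' q q' c xs v : q <= q' -> (forall x, x < q -> f' x = f x) ->
  stepf f q c xs = v.+1 -> stepf f' q' c xs = v.+1.
Proof.
move=> leq_q ff'; elim/code_nested_ind: c xs v => //=.
- case=> // x _ v; case: ltnP => // ltx; rewrite (leq_trans ltx leq_q).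
  by rewrite ff'.
- move=> c cs IHc IHcs xs v; case: ifP => // /allP nz.
  have E : [seq stepf f' q' d xs | d <- cs] = [seq stepf f q d xs | d <- cs].
    apply: (@eq_from_nth _ 0) => [|i]; rewrite !size_map // => lti.
    rewrite !(nth_map CZero) //.
    have : stepf f q (nth CZero cs i) xs != 0.
      by apply: nz; apply: map_f; rewrite mem_nth.
    by case Es: (stepf f q _ _) => [|w] // _; apply: IHcs.
  by rewrite E => /IHc ->; case: ifP => // /negP[]; apply/allP.
- move=> c d IHc IHd [//|n xs] v.
  elim: n v => [|n IHn] v /=; first exact: IHc.
  case E: (prec_iter _ _ n) => [|y] //=.
  by rewrite (IHn _ E) /=; apply: IHd.
- move=> c IHc xs v.
  case E: (mu_scan _ _) => [|[|n]] //= [<-].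
  have [ltn vn vi] := mu_scanP E.
  rewrite (@mu_scan_found _ n) //.
  + move=> i /vi; case Ev: (stepf _ _ _ _) => [|w] //.
    by rewrite (IHc _ _ Ev).
  + exact: IHc.
  + exact: leq_trans leq_q.
Qed.

Lemma stepf_sound f q c xs v : stepf f q c xs = v.+1 -> eval f c xs v.
Proof.
elim/code_nested_ind: c xs v => //=.
- by move=> xs v [<-]; constructor.
- by case=> // x xs v [<-]; constructor.
- by move=> i xs v; case: ifP => // lti [<-]; constructor.
- by case=> // x xs v; case: ifP => // _ [<-]; constructor.
- move=> c cs IHc IHcs xs v; case: ifP => // /allP nz /IHc ev.
  apply: EvComp ev; first by rewrite !size_map.
  move=> i lti; apply: IHcs => //.
  rewrite (nth_map 0) ?size_map // (nth_map CZero) // prednK //.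
  by rewrite lt0n; apply: nz; apply: map_f; rewrite mem_nth.
- move=> c d IHc IHd [//|n xs] v.
  elim: n v => [|n IHn] v /=; first by move/IHc; constructor.
  case E: (prec_iter _ _ n) => [|y] //= /IHd; exact: EvPrecS (IHn _ E).
- move=> c IHc xs v.
  case E: (mu_scan _ _) => [|[|n]] //= [<-].
  have [ltn vn vi] := mu_scanP E.
  apply: (@EvMu _ _ _ _ (fun i => (stepf f q c (i :: xs)).-2)).
    by move=> i /vi; case Ev: (stepf _ _ _ _) => [|[|w]] // _; apply: IHc.
  exact: IHc.
Qed.

Lemma choose_bound n (P : nat -> nat -> Prop) :
  (forall i, i < n -> exists q0, forall q, q0 <= q -> P i q) ->
  exists q0, forall i q, i < n -> q0 <= q -> P i q.
Proof.
elim: n => [|n IH] H; first by exists 0.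
have [|q0 Hq0] := IH; first by move=> i /leqW; apply: H.
have [q1 Hq1] := H n (leqnn _).
exists (maxn q0 q1) => i q; rewrite ltnS geq_max => + /andP[le0 le1].
by rewrite leq_eqVlt => /predU1P[->|lti]; [apply: Hq1|apply: Hq0].
Qed.

Lemma stepf_complete f c xs v : eval f c xs v ->
  exists q0, forall q, q0 <= q -> stepf f q c xs = v.+1.
Proof.
elim=> {c xs v} /=.
- by exists 0.
- by exists 0.
- by move=> i xs lti; exists 0; rewrite lti.
- by move=> x _; exists x.+1 => q ->.
- move=> c cs xs ys z szs _ /choose_bound[q0 H0] _ [q1 H1].
  exists (maxn q0 q1) => q; rewrite geq_max => /andP[le0 le1].
  have E : [seq stepf f q d xs | d <- cs] = map succn ys.
    apply: (@eq_from_nth _ 0) => [|i]; rewrite !size_map // => lti.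
    by rewrite (nth_map CZero) // (nth_map 0) ?szs //; apply: H0.
  rewrite E all_map (eq_all (a2 := predT)) // all_predT.
  by rewrite -map_comp map_id_in // H1.
- by move=> c d xs y _ [q0 H]; exists q0.
- move=> c d n xs y z _ [q0 H0] _ [q1 H1].
  exists (maxn q0 q1) => q; rewrite geq_max => /andP[le0 le1].
  by rewrite H0 //= H1.
- move=> c xs n k _ /choose_bound[q0 H0] _ [q1 H1].
  exists (maxn n.+1 (maxn q0 q1)) => q; rewrite !geq_max => /and3P[ltn le0 le1].
  rewrite (@mu_scan_found _ n) //; last exact: H1.
  by move=> i lti; rewrite H0.
Qed.

Lemma eval_use f c xs v : eval f c xs v ->
  exists q, forall f', (forall x, x < q -> f' x = f x) -> eval f' c xs v.
Proof.
move=> /stepf_complete[q /(_ q (leqnn _)) Eq]; exists q => f' ff'.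
exact: stepf_sound (stepf_mono (leqnn q) ff' Eq).
Qed.

(** * Total computable functionals *)

Definition computes (n : nat) (F : baire -> seq nat -> nat) : Prop :=
  exists c, forall k xs, size xs = n -> eval k c xs (F k xs).

Definition computes_list (n m : nat) (gs : baire -> seq nat -> seq nat) : Prop :=
  (forall k xs, size xs = n -> size (gs k xs) = m) /\
  forall i, i < m -> computes n (fun k xs => nth 0 (gs k xs) i).

Lemma computes_ext n F G : (forall k xs, size xs = n -> F k xs = G k xs) ->
  computes n F -> computes n G.
Proof. by move=> FG [c cF]; exists c => k xs sz; rewrite -FG //; apply: cF. Qed.

Lemma computes_args n m F gs : computes m F -> computes_list n m gs ->
  computes n (fun k xs => F k (gs k xs)).
Proof.
move=> [c cF] [sgs cgs].
have /choice[d dP] : forall i, exists d, i < m ->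
    forall k xs, size xs = n -> eval k d xs (nth 0 (gs k xs) i).
  move=> i; case: (ltnP i m) => [/cgs[d dP]|_]; last by exists CZero.
  by exists d.
exists (CComp c (mkseq d m)) => k xs sz.
apply: (@EvComp _ _ _ _ (gs k xs)); last by apply: cF; apply: sgs.
  by rewrite size_mkseq sgs.
by move=> i; rewrite size_mkseq => lti; rewrite nth_mkseq //; apply: dP.
Qed.

Lemma computes_list_id n : computes_list n n (fun _ xs => xs).
Proof.
split=> // i lti; exists (CProj i) => k xs sz; constructor; by rewrite sz.
Qed.

Lemma computes_proj n i : i < n -> computes n (fun _ xs => nth 0 xs i).
Proof. by case: (computes_list_id n) => _; apply. Qed.

Lemma computes_list_nil n : computes_list n 0 (fun _ _ => [::]).
Proof. by []. Qed.

Lemma computes_list_cons n m G gs : computes n G -> computes_list n m gs ->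
  computes_list n m.+1 (fun k xs => G k xs :: gs k xs).
Proof.
move=> cG [sgs cgs]; split=> [k xs sz /=|[|i] lti //=]; first by rewrite sgs.
exact: cgs.
Qed.

Lemma computes_list_drop n m j gs : computes_list n (j + m) gs ->
  computes_list n m (fun k xs => drop j (gs k xs)).
Proof.
move=> [sgs cgs]; split=> [k xs sz|i lti]; first by rewrite size_drop sgs // addKn.
apply: computes_ext (cgs (j + i) _); last by rewrite ltn_add2l.
by move=> k xs sz; rewrite nth_drop.
Qed.

Lemma computes_list_cat n m1 m2 gs1 gs2 :
  computes_list n m1 gs1 -> computes_list n m2 gs2 ->
  computes_list n (m1 + m2) (fun k xs => gs1 k xs ++ gs2 k xs).
Proof.
move=> [s1 c1] [s2 c2]; split=> [k xs sz|i lti]; first by rewrite size_cat s1 // s2.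
case: (ltnP i m1) => lei.
  by apply: computes_ext (c1 i lei) => k xs sz; rewrite nth_cat s1 // lei.
apply: computes_ext (c2 (i - m1) _); last by rewrite ltn_subLR.
by move=> k xs sz; rewrite nth_cat s1 // ltnNge lei.
Qed.

Lemma computes_const n v : computes n (fun _ _ => v).
Proof.
elim: v => [|v [c IH]]; first by exists CZero => *; constructor.
exists (CComp CSucc [:: c]) => k xs sz.
by apply: (@EvComp _ _ _ _ [:: v]) => // [[|//] _|]; [apply: IH|constructor].
Qed.

Lemma computes_succ n F : computes n F -> computes n (fun k xs => (F k xs).+1).
Proof.
move=> [c cF]; exists (CComp CSucc [:: c]) => k xs sz.
by apply: (@EvComp _ _ _ _ [:: F k xs]) => // [[|//] _|]; [apply: cF|constructor].
Qed.

Lemma computes_oracle n F : computes n F -> computes n (fun k xs => k (F k xs)).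
Proof.
move=> [c cF]; exists (CComp COracle [:: c]) => k xs sz.
by apply: (@EvComp _ _ _ _ [:: F k xs]) => // [[|//] _|]; [apply: cF|constructor].
Qed.

Lemma computes_prec n F G N : computes n F -> computes n.+2 G -> computes n N ->
  computes n
    (fun k xs => prec_iter (F k xs) (fun i y => G k [:: i, y & xs]) (N k xs)).
Proof.
move=> [c cF] [d dG] cN.
have cP : computes n.+1 (fun k zs => prec_iter (F k (behead zs))
    (fun i y => G k [:: i, y & behead zs]) (head 0 zs)).
  exists (CPrec c d) => k [|m xs] //= [sz].
  elim: m => [|m IH] /=; first by constructor; apply: cF.
  by apply: EvPrecS IH _; apply: dG; rewrite /= sz.
exact: computes_args cP (computes_list_cons cN (computes_list_id n)).
Qed.

Lemma computes_pred n F : computes n F -> computes n (fun k xs => (F k xs).-1).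
Proof.
move=> cF; apply: computes_ext
  (computes_prec (computes_const n 0) (@computes_proj n.+2 0 isT) cF).
by move=> k xs _; case: (F k xs).
Qed.

Lemma computes_add n F G : computes n F -> computes n G ->
  computes n (fun k xs => F k xs + G k xs).
Proof.
move=> cF cG; apply: computes_ext
  (computes_prec cF (computes_succ (@computes_proj n.+2 1 isT)) cG).
by move=> k xs _; elim: (G k xs) => [|m /= ->]; rewrite ?addn0 ?addnS.
Qed.

Lemma computes_sub n F G : computes n F -> computes n G ->
  computes n (fun k xs => F k xs - G k xs).
Proof.
move=> cF cG; apply: computes_ext
  (computes_prec cF (computes_pred (@computes_proj n.+2 1 isT)) cG).
by move=> k xs _; elim: (G k xs) => [|m /= ->]; rewrite ?subn0 ?subnS.
Qed.

Lemma computes_shift n m F : computes n F ->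
  computes (m + n) (fun k xs => F k (drop m xs)).
Proof.
move=> cF; apply: computes_args cF _.
exact/computes_list_drop/computes_list_id.
Qed.

(** A conditional is a primitive recursion of length 0 or 1. *)
Lemma computes_if n (b : baire -> seq nat -> bool) F G :
  computes n (fun k xs => b k xs : nat) -> computes n F -> computes n G ->
  computes n (fun k xs => if b k xs then F k xs else G k xs).
Proof.
move=> cb cF cG; apply: computes_ext
  (computes_prec cG (@computes_shift n 2 _ cF) cb).
by move=> k xs _; case: (b k xs) => //=; rewrite drop0.
Qed.

Lemma computes_ltn n F G : computes n F -> computes n G ->
  computes n (fun k xs => (F k xs < G k xs) : nat).
Proof.
move=> cF cG; apply: computes_ext (computes_sub (computes_const n 1)
  (computes_sub (computes_succ cF) cG)) => k xs _.
by rewrite /leq; case: (_ - G k xs).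
Qed.

Lemma computes_eqn n F G : computes n F -> computes n G ->
  computes n (fun k xs => (F k xs == G k xs) : nat).
Proof.
move=> cF cG; apply: computes_ext (computes_sub (computes_const n 1)
  (computes_add (computes_sub cF cG) (computes_sub cG cF))) => k xs _.
by rewrite eqn_leq /leq -addn_eq0; case: (_ + _).
Qed.

Lemma computes_andb n (b b' : baire -> seq nat -> bool) :
  computes n (fun k xs => b k xs : nat) ->
  computes n (fun k xs => b' k xs : nat) ->
  computes n (fun k xs => (b k xs && b' k xs) : nat).
Proof.
move=> cb cb'; apply: computes_ext (computes_if cb cb' (computes_const n 0)).
by move=> k xs _; case: (b k xs).
Qed.

Lemma computes_odd n F : computes n F -> computes n (fun k xs => odd (F k xs) : nat).
Proof.
move=> cF; apply: computes_ext (computes_prec (computes_const n 0)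
  (computes_sub (computes_const n.+2 1) (@computes_proj n.+2 1 isT)) cF).
by move=> k xs _; elim: (F k xs) => //= m ->; case: (odd m).
Qed.

Lemma computes_half n F : computes n F -> computes n (fun k xs => (F k xs)./2).
Proof.
move=> cF; apply: computes_ext (computes_prec (computes_const n 0)
  (computes_add (computes_odd (@computes_proj n.+2 0 isT))
    (@computes_proj n.+2 1 isT)) cF).
by move=> k xs _; elim: (F k xs) => //= m ->; rewrite uphalf_half.
Qed.

(** A number stands for the eventually zero sequence of its binary digits, so a search over numbers
    meets every finite string. *)
Definition bit (p i : nat) : bool := odd (iter i half p).

Lemma computes_bit n F G : computes n F -> computes n G ->
  computes n (fun k xs => bit (F k xs) (G k xs) : nat).
Proof.
move=> cF cG; apply: computes_ext (computes_odd (computes_prec cF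
  (computes_half (@computes_proj n.+2 1 isT)) cG)).
by move=> k xs _; rewrite /bit; congr (odd _ : nat); elim: (G k xs) => //= m ->.
Qed.

Lemma computes_all n cs (G : code -> baire -> seq nat -> nat) :
  (forall i, i < size cs -> computes n (G (nth CZero cs i))) ->
  computes n (fun k xs => all (fun y => y != 0) [seq G d k xs | d <- cs] : nat).
Proof.
elim: cs => [|d cs IH] H; first exact: computes_const.
apply: computes_andb; last by apply: IH => i lti; apply: (H i.+1).
apply: computes_ext
  (computes_ltn (computes_const n 0) (H 0 isT)) => k xs _.
by rewrite lt0n.
Qed.

(* The list of arguments is followed by a list of [r] parameters, on which both
   the oracle and the bound may depend. *)
Lemma computes_stepf_params r (O : baire -> seq nat -> baire) Q c n :
  computes r.+1 (fun k zs => O k (behead zs) (head 0 zs)) -> computes r Q ->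
  computes (n + r) (fun k zs =>
    stepf (O k (drop n zs)) (Q k (drop n zs)) c (take n zs)).
Proof.
move=> cO cQ; elim/code_nested_ind: c n => /=.
- by move=> n; apply: computes_const.
- case=> [|n]; first by apply: computes_ext (computes_const _ 0) => k zs; rewrite take0.
  apply: computes_ext (computes_succ (computes_succ (@computes_proj (n.+1 + r) 0 isT))).
  by move=> k [|x zs].
- move=> i n; case: (ltnP i n) => lei; last first.
    apply: computes_ext (computes_const _ 0) => k zs sz.
    by rewrite size_takel ?sz ?leq_addr // ltnNge lei.
  apply: computes_ext (computes_succ (@computes_proj (n + r) i _)).
    by move=> k zs sz; rewrite size_takel ?sz ?leq_addr // lei nth_take.
  exact: leq_trans (leq_addr _ _).
- case=> [|n]; first by apply: computes_ext (computes_const _ 0) => k zs; rewrite take0.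
  have cx := @computes_proj (n.+1 + r) 0 isT.
  apply: computes_ext (computes_if (computes_ltn cx (@computes_shift _ n.+1 _ cQ))
    (computes_succ (computes_args cO (computes_list_cons cx
       (computes_list_drop (computes_list_id (n.+1 + r))))))
    (computes_const _ 0)).
  by move=> k [|x zs] sz.
- move=> c cs IHc IHcs n.
  pose G d k zs := stepf (O k (drop n zs)) (Q k (drop n zs)) d (take n zs).
  apply: (computes_if (computes_all (G := G) _) _ (computes_const _ 0)).
    by move=> i lti; apply: IHcs.
  have cl : computes_list (n + r) (size cs + r)
      (fun k zs => [seq (G d k zs).-1 | d <- cs] ++ drop n zs).
    apply: computes_list_cat; last exact/computes_list_drop/computes_list_id.
    split=> [k zs _|i lti]; first by rewrite size_map.
    apply: computes_ext (computes_pred (IHcs i lti n)) => k zs _.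
    by rewrite (nth_map CZero).
  apply: computes_ext (computes_args (IHc (size cs)) cl) => k zs _.
  rewrite drop_size_cat ?size_map // take_size_cat ?size_map // -map_comp.
  by [].
- move=> c d IHc IHd [|n].
    by apply: computes_ext (computes_const _ 0) => k zs; rewrite take0.
  pose m := n.+1 + r.
  have cG : computes m.+2 (fun k zs => if nth 0 zs 1 == 0 then 0 else
     stepf (O k (drop n.+2 (nth 0 zs 0 :: (nth 0 zs 1).-1 :: drop 3 zs)))
       (Q k (drop n.+2 (nth 0 zs 0 :: (nth 0 zs 1).-1 :: drop 3 zs))) d
       (take n.+2 (nth 0 zs 0 :: (nth 0 zs 1).-1 :: drop 3 zs))).
    apply: computes_if; last 1 first.
    - apply: computes_args (IHd n.+2) _; rewrite !addSn.
      apply: computes_list_cons; first exact: computes_proj.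
      apply: computes_list_cons; first exact/computes_pred/computes_proj.
      exact/computes_list_drop/computes_list_id.
    - exact: computes_eqn (computes_proj _) (computes_const _ 0).
    - exact: computes_const.
  apply: computes_ext (computes_prec (@computes_shift _ 1 _ (IHc n)) cG
    (@computes_proj m 0 isT)).
  by move=> k [|x zs] //= _; rewrite drop0.
- move=> c IHc n; apply: computes_pred; pose m := n + r.
  have cS : computes m.+2 (fun k zs =>
      stepf (O k (drop n.+1 (nth 0 zs 0 :: drop 2 zs)))
       (Q k (drop n.+1 (nth 0 zs 0 :: drop 2 zs))) c
       (take n.+1 (nth 0 zs 0 :: drop 2 zs))).
    apply: computes_args (IHc n.+1) _; rewrite addSn.
    apply: computes_list_cons; first exact: computes_proj.
    exact/computes_list_drop/computes_list_id.
  have c0 := computes_const m.+2 0; have c1 := computes_const m.+2 1.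
  have cG := computes_if
    (computes_eqn (@computes_proj m.+2 1 isT) c0)
    (computes_if (computes_eqn cS c0) c1
       (computes_if (computes_eqn cS c1)
          (computes_succ (computes_succ (@computes_proj m.+2 0 isT))) c0))
    (@computes_proj m.+2 1 isT).
  apply: computes_ext (computes_prec (computes_const m 0) cG
    (@computes_shift _ n _ cQ)).
  by move=> k zs sz /=; rewrite drop0.
Qed.

Lemma computes_stepf n r (O : baire -> seq nat -> baire) Q c X ps :
  computes r.+1 (fun k zs => O k (behead zs) (head 0 zs)) -> computes r Q ->
  computes n X -> computes_list n r ps ->
  computes n (fun k xs => stepf (O k (ps k xs)) (Q k (ps k xs)) c [:: X k xs]).
Proof.
move=> cO cQ cX cps; apply: computes_ext (computes_args
  (computes_stepf_params c 1 cO cQ) (computes_list_cons cX cps)) => k xs _ /=.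
by rewrite drop0 take0.
Qed.

(** * Criteria for Medvedev reducibility *)

Lemma medvedev_le_functional (D K : mass_problem) c :
  (forall k, K k -> exists2 y, D y & Phi c k y) -> medvedev_le D K.
Proof.
move=> H; exists c; split=> [k /H[y _ ky]|y [k /H[y' Dy' ky'] ky]].
  by exists y.
by rewrite (Phi_det ky ky').
Qed.

Lemma medvedev_leP (D K : mass_problem) : medvedev_le D K ->
  exists c, forall k, K k -> exists2 y, D y & Phi c k y.
Proof.
move=> [c [Kc cD]]; exists c => k Kk; have [y ky] := Kc _ Kk.
by exists y => //; apply: cD; exists k.
Qed.

Lemma medvedev_le_total (D K : mass_problem) F : computes 1 F ->
  (forall k, K k -> D (fun n => F k [:: n])) -> medvedev_le D K.
Proof.
move=> [c cF] H; apply: (@medvedev_le_functional _ _ c) => k /H Dk.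
by exists (fun n => F k [:: n]) => // n; apply: cF.
Qed.

(** Stage [s] answers 0 for undecided and [v.+1] for the value [v]. Every answering stage is
    required to be right, so the first one may be used. *)
Lemma medvedev_le_search (D K : mass_problem) T : computes 2 T ->
  (forall k, K k -> exists2 y, D y & forall n,
     (exists s, T k [:: n; s] = (y n).+1) /\
     (forall s v, T k [:: n; s] = v.+1 -> v = y n)) -> medvedev_le D K.
Proof.
move=> cT H.
(* The minimised argument is the head of the list, so [s] comes before [n]; the value is 0 exactly
   when stage [s] answers. *)
have [cs csP] : computes 2 (fun k zs => 1 - T k [:: nth 0 zs 1; nth 0 zs 0]).
  apply: computes_sub (computes_const _ _) (computes_args cT _).
  by do 2 (apply: computes_list_cons; first exact: computes_proj).
have [cv cvP] : computes 2 (fun k zs => (T k [:: nth 0 zs 1; nth 0 zs 0]).-1).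
  apply: computes_pred; apply: computes_args cT _.
  by do 2 (apply: computes_list_cons; first exact: computes_proj).
apply: (@medvedev_le_functional _ _ (CComp cv [:: CMu cs; CProj 0])) => k /H[y Dy yP].
exists y => // n; have [[s0 Es0] yv] := yP n.
have exs : exists s, T k [:: n; s] != 0 by exists s0; rewrite Es0.
pose s := ex_minn exs; have [Es mins] : T k [:: n; s] != 0 /\
    forall t, T k [:: n; t] != 0 -> s <= t by rewrite /s; case: ex_minnP.
apply: (@EvComp _ _ _ _ [:: s; n]) => //.
- move=> [|[|//]] _ /=; last exact: (@EvProj k 0 [:: n]).
  apply: (@EvMu _ _ _ _ (fun=> 0)) => [i lti|].
    have /eqP T0 : T k [:: n; i] == 0.
      by apply: contraTT lti => /mins; rewrite -leqNgt.
    by have := csP k [:: i; n] erefl; rewrite /= T0.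
  have := csP k [:: s; n] erefl; rewrite /=.
  by case: (T _ _) Es.
- have := cvP k [:: s; n] erefl; rewrite /=.
  by case E: (T _ _) Es => [|v] // _; rewrite (yv _ _ E).
Qed.

(** * Lattice operations and case distinctions *)

Definition pre (v : nat) (f : baire) : baire :=
  fun n => if n is m.+1 then f m else v.

Definition tail (y : baire) : baire := fun n => y n.+1.

Definition join (f g : baire) : baire :=
  fun n => if odd n then g n./2 else f n./2.

Definition left_part (y : baire) : baire := fun n => y n.*2.

Definition right_part (y : baire) : baire := fun n => y n.*2.+1.

Definition meet (B F : mass_problem) : mass_problem :=
  (pre 0 @` B) `|` (pre 1 @` F).

Lemma tail_pre v f : tail (pre v f) = f.
Proof. by []. Qed.

Lemma left_join f g : left_part (join f g) = f.
Proof. by apply/funext => n; rewrite /left_part /join odd_double doubleK. Qed.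

Lemma right_join f g : right_part (join f g) = g.
Proof.
by apply/funext => n; rewrite /right_part /join /= odd_double /= uphalf_double.
Qed.

Lemma medvedev_le_sub (D K : mass_problem) : K `<=` D -> medvedev_le D K.
Proof.
move=> KD; apply: (medvedev_le_total (F := fun k xs => k (nth 0 xs 0))) => [|k Kk].
  exact/computes_oracle/computes_proj.
exact: KD.
Qed.

Lemma medvedev_le_pre v D : medvedev_le (pre v @` D) D.
Proof.
have cP : computes 1 (fun k xs =>
    if nth 0 xs 0 == 0 then v else k (nth 0 xs 0).-1).
  apply: computes_if (computes_const _ _) _.
    exact: computes_eqn (computes_proj _) (computes_const _ _).
  exact/computes_oracle/computes_pred/computes_proj.
by apply: (medvedev_le_total cP) => k Dk; exists k => //; apply/funext => -[].
Qed.

Lemma medvedev_le_tail (D K : mass_problem) :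
  (forall k, K k -> D (tail k)) -> medvedev_le D K.
Proof.
apply: (medvedev_le_total (F := fun k xs => k (nth 0 xs 0).+1)).
exact/computes_oracle/computes_succ/computes_proj.
Qed.

Lemma medvedev_le_left (D K : mass_problem) :
  (forall k, K k -> D (left_part k)) -> medvedev_le D K.
Proof.
have cP : computes 1 (fun k xs => k (nth 0 xs 0 + nth 0 xs 0)).
  by apply: computes_oracle; apply: computes_add; apply: computes_proj.
move=> H; apply: (medvedev_le_total cP) => k /H; congr D.
by apply/funext => n; rewrite /left_part -addnn.
Qed.

Lemma medvedev_le_meetl B F : medvedev_le (meet B F) B.
Proof.
apply: medvedev_le_trans (medvedev_le_pre 0 B).
by apply: medvedev_le_sub => k Bk; left.
Qed.

Lemma medvedev_le_meetr B F : medvedev_le (meet B F) F.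
Proof.
apply: medvedev_le_trans (medvedev_le_pre 1 F).
by apply: medvedev_le_sub => k Bk; right.
Qed.

Lemma computes_stepf_self n c X Q : computes n X -> computes n Q ->
  computes n (fun k xs => stepf k (Q k xs) c [:: X k xs]).
Proof.
move=> cX cQ; have cO : computes 2 (fun k zs => k (head 0 zs)).
  apply: computes_ext (computes_oracle (@computes_proj 2 0 isT)).
  by move=> k [].
have cq := @computes_proj 1 0 isT.
exact: (computes_stepf (O := fun k _ => k) c cO cq cX
  (computes_list_cons cQ (computes_list_nil n))).
Qed.

(** A finite computation decides whether [h x = v], and the reduction fitting that case is run
    afterwards. *)
Lemma medvedev_le_branch (D K : mass_problem) d x v :
  (forall k, K k -> exists h, Phi d k h) ->
  medvedev_le D [set k | K k /\ forall h, Phi d k h -> h x = v] ->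
  medvedev_le D [set k | K k /\ forall h, Phi d k h -> h x <> v] ->
  medvedev_le D K.
Proof.
move=> Kd /medvedev_leP[c1 c1P] /medvedev_leP[c2 c2P].
have cw := computes_stepf_self d (computes_const 2 x) (@computes_proj 2 1 isT).
have cT := computes_if (computes_eqn cw (computes_const 2 0)) (computes_const 2 0)
  (computes_if (computes_eqn cw (computes_const 2 v.+1))
    (computes_stepf_self c1 (@computes_proj 2 0 isT) (@computes_proj 2 1 isT))
    (computes_stepf_self c2 (@computes_proj 2 0 isT) (@computes_proj 2 1 isT))).
apply: (medvedev_le_search cT) => k Kk /=.
have [h dkh] := Kd _ Kk; have [q0 Eq0] := stepf_complete (dkh x).
have hx s : stepf k s d [:: x] != 0 -> stepf k s d [:: x] = (h x).+1.
  by case E: stepf => [|w] // _; rewrite (eval_det (stepf_sound E) (dkh x)).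
have found c y : Phi c k y ->
    forall n, exists s, q0 <= s /\ stepf k s c [:: n] = (y n).+1.
  move=> cky n; have [q1 Eq1] := stepf_complete (cky n).
  by exists (maxn q0 q1); rewrite leq_maxl Eq1 // leq_maxr.
have [hv|hv] := pselect (h x = v).
  have [|y Dy ky] := c1P k; first by split=> // h' /(Phi_det dkh) <-.
  exists y => // n; split=> [|s w].
    have [s [les Es]] := found _ _ ky n.
    by exists s; rewrite Eq0 //= hv eqxx.
  case: eqP => // /eqP /hx ->; rewrite hv eqxx => E.
  exact: eval_det (stepf_sound E) (ky n).
have [|y Dy ky] := c2P k; first by split=> // h' /(Phi_det dkh) <-.
exists y => // n; split=> [|s w].
  have [s [les Es]] := found _ _ ky n.
  by exists s; rewrite Eq0 //= eqSS; move/eqP/negbTE: hv => ->.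
case: eqP => // /eqP /hx ->; rewrite eqSS; move/eqP/negbTE: (hv) => -> E.
exact: eval_det (stepf_sound E) (ky n).
Qed.

Lemma Phi_oracle k : Phi COracle k k.
Proof. by move=> n; constructor. Qed.

Lemma medvedev_meet_le D B F :
  medvedev_le D B -> medvedev_le D F -> medvedev_le D (meet B F).
Proof.
move=> DB DF; apply: (@medvedev_le_branch _ _ COracle 0 0).
- by move=> k _; exists k; apply: Phi_oracle.
- apply: medvedev_le_trans DB _; apply: medvedev_le_tail => k [+ /(_ _ (Phi_oracle k))].
  by case=> -[f Ff <-].
- apply: medvedev_le_trans DF _; apply: medvedev_le_tail => k [+ /(_ _ (Phi_oracle k))].
  by case=> -[f Ff <-].
Qed.

(** * Baire category *)

Definition app (tau : seq nat) (alpha : nat -> bool) : baire :=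
  fun n => if n < size tau then nth 0 tau n else alpha (n - size tau).

Definition ext (sigma : seq bool) (alpha : nat -> bool) : Prop :=
  forall i, i < size sigma -> alpha i = nth false sigma i.

(** That is, [P] contains a dense open set; [P] itself need not be open. *)
Definition dense_open (P : set (nat -> bool)) : Prop :=
  forall sigma, exists rho, forall alpha, ext (sigma ++ rho) alpha -> P alpha.

Definition dense_open2 (P : (nat -> bool) -> (nat -> bool) -> Prop) : Prop :=
  forall sigma tau, exists rho rho', forall alpha beta,
    ext (sigma ++ rho) alpha -> ext (tau ++ rho') beta -> P alpha beta.

Definition comeager (Q : set (nat -> bool)) : Prop :=
  exists P : nat -> set (nat -> bool),
    (forall n, dense_open (P n)) /\ forall alpha, (forall n, P n alpha) -> Q alpha.

Lemma comeager_countable (T : countType) (P : T -> set (nat -> bool)) :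
  (forall t, dense_open (P t)) -> comeager [set alpha | forall t, P t alpha].
Proof.
move=> dP; exists (fun n => if unpickle n is Some t then P t else setT).
split=> [n|alpha H t]; last by have := H (pickle t); rewrite pickleK.
by case: (unpickle n) => // sigma; exists [::].
Qed.

Lemma app_shift tau alpha n : app tau alpha (size tau + n) = alpha n.
Proof. by rewrite /app ltnNge leq_addr addKn. Qed.

Lemma ext_prefix sigma sigma' alpha :
  prefix sigma sigma' -> ext sigma' alpha -> ext sigma alpha.
Proof.
move=> /prefixP[rho ->] H i lti.
by rewrite H ?size_cat ?nth_cat ?lti // ltn_addr.
Qed.

Lemma ext_catl sigma rho alpha : ext (sigma ++ rho) alpha -> ext sigma alpha.
Proof. exact/ext_prefix/prefix_prefix. Qed.

Lemma ext_approx sigma alpha n : ext sigma alpha -> exists rho,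
  ext (sigma ++ rho) alpha /\
  forall beta, ext (sigma ++ rho) beta -> forall i, i < n -> beta i = alpha i.
Proof.
move=> sa; pose rho := mkseq (fun i => alpha (size sigma + i)) n.
have E i : i < size sigma + n -> nth false (sigma ++ rho) i = alpha i.
  move=> lti; rewrite nth_cat; case: (ltnP i (size sigma)) => le; first by rewrite sa.
  by rewrite nth_mkseq ?subnKC // ltn_subLR.
exists rho; split=> [i|beta sb i lti].
  by rewrite size_cat size_mkseq => /E ->.
have lti' : i < size sigma + n by rewrite ltn_addl.
by rewrite sb ?size_cat ?size_mkseq // E.
Qed.

Lemma half_le i : i./2 <= i.
Proof. by rewrite -[leqRHS]odd_double_half -addnn addnA leq_addl. Qed.

Lemma eval_use_app f tau alpha sigma e xs v :
  ext sigma alpha -> eval (join f (app tau alpha)) e xs v ->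
  exists rho, ext (sigma ++ rho) alpha /\ forall beta, ext (sigma ++ rho) beta ->
    eval (join f (app tau beta)) e xs v.
Proof.
move=> sa /eval_use[q qP]; have [rho [ra rP]] := ext_approx q sa.
exists rho; split=> // beta /rP agree; apply: qP => x ltx.
rewrite /join; case: ifP => // _; rewrite /app; case: ifP => // _.
rewrite agree //.
exact: leq_ltn_trans (leq_trans (leq_subr _ _) (half_le x)) ltx.
Qed.

Section Mycielski.
Variables (T : countType) (P : T -> (nat -> bool) -> (nat -> bool) -> Prop).
Hypothesis dP : forall t, dense_open2 (P t).

Let meets n sigma tau := forall t : T, unpickle n = Some t ->
  forall alpha beta, ext sigma alpha -> ext tau beta -> P t alpha beta.

Let meets_prefix n sigma sigma' tau tau' :
  prefix sigma sigma' -> prefix tau tau' -> meets n sigma tau ->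
  meets n sigma' tau'.
Proof.
move=> ps pt m t tn alpha beta /(ext_prefix ps) sa /(ext_prefix pt) tb.
exact: m.
Qed.

(** The requirements are met one after another; prolonging the strings keeps those met before, by
    [meets_prefix]. *)
Let extend (L : seq (nat * (seq bool * seq bool))) (s : seq bool -> seq bool) :
  exists s' : seq bool -> seq bool, (forall u, prefix (s u) (s' u)) /\
    forall n u v, (n, (u, v)) \in L -> u <> v -> meets n (s' u) (s' v).
Proof.
elim: L => [|[n [u v]] L [s1 [ss1 s1P]]]; first by exists s; split=> // u; apply: prefix_refl.
have [uv|/eqP uv] := eqVneq u v.
  exists s1; split=> // n' u' v'; rewrite inE => /predU1P[[_ -> ->] /(_ uv)//|].
  exact: s1P.
have [rho [rho' rP]] : exists rho rho', meets n (s1 u ++ rho) (s1 v ++ rho').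
  case E: (unpickle n : option T) => [t|]; last by exists [::], [::] => t; rewrite E.
  have [rho [rho' H]] := dP t (s1 u) (s1 v).
  by exists rho, rho' => t'; rewrite E => -[<-].
pose s2 w := if w == u then s1 u ++ rho else if w == v then s1 v ++ rho' else s1 w.
have s12 w : prefix (s1 w) (s2 w).
  rewrite /s2; case: eqP => [->|_]; first exact: prefix_prefix.
  by case: eqP => [->|_]; rewrite ?prefix_prefix ?prefix_refl.
exists s2; split=> [w|n' u' v']; first exact: prefix_trans (ss1 w) (s12 w).
rewrite inE => /predU1P[[-> -> ->] _|inL uv'].
  by rewrite /s2 !eqxx ifN ?eqxx //; apply/eqP => vu; apply: uv.
exact: meets_prefix (s12 _) (s12 _) (s1P _ _ _ inL uv').
Qed.

(** The letter [false] is appended first to make the strings grow, so that each branch determines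
    all bits. *)
Let level l (s : seq bool -> seq bool) : exists s' : seq bool -> seq bool,
  (forall u, prefix (rcons (s (take l u)) false) (s' u)) /\
  forall n u v, n <= l -> size u = l.+1 -> size v = l.+1 -> u <> v ->
    meets n (s' u) (s' v).
Proof.
pose us := [seq val t | t <- enum {: l.+1.-tuple bool}].
have inus u : size u = l.+1 -> u \in us.
  move=> /eqP sz; apply/mapP; exists (Tuple sz) => //.
  by rewrite mem_enum.
pose L := [seq (n, w) | n <- iota 0 l.+1, w <- [seq (u, v) | u <- us, v <- us]].
have [s' [ss' s'P]] := extend L (fun u => rcons (s (take l u)) false).
exists s'; split=> // n u v len su sv; apply: s'P.
apply: allpairs_f; first by rewrite mem_iota.
by apply: allpairs_f; apply: inus.
Qed.

(** Mycielski's theorem. A tree of strings is grown in which any two distinct nodes produced at step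
    [l] meet the requirements up to [l]; distinct branches pass through distinct nodes from some
    level on. *)
Lemma mycielski : exists a : (nat -> bool) -> (nat -> bool),
  forall x y, x <> y -> forall t, P t (a x) (a y).
Proof.
have /choice[st stP] : forall ls : nat * (seq bool -> seq bool), exists s',
    (forall u, prefix (rcons (ls.2 (take ls.1 u)) false) (s' u)) /\
    forall n u v, n <= ls.1 -> size u = ls.1.+1 -> size v = ls.1.+1 -> u <> v ->
      meets n (s' u) (s' v) by move=> [l s]; apply: level.
pose S := fix S l := if l is l'.+1 then st (l', S l') else fun=> [::].
pose c x l := S l (mkseq x l).
have takeS x l : take l (mkseq x l.+1) = mkseq x l.
  by rewrite /mkseq -[l.+1]addn1 iotaD map_cat take_size_cat // size_map size_iota.
have cS x l : prefix (rcons (c x l) false) (c x l.+1).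
  by rewrite /c /=; have [/(_ (mkseq x l.+1)) + _] := stP (l, S l); rewrite /= takeS.
have cle x l l' : l <= l' -> prefix (c x l) (c x l').
  elim: l' => [|l' IH]; first by rewrite leqn0 => /eqP ->; apply: prefix_refl.
  rewrite leq_eqVlt => /predU1P[->|/IH]; first exact: prefix_refl.
  by move/prefix_trans; apply; apply: prefix_trans (prefix_rcons _ _) (cS x l').
have sc x l : l <= size (c x l).
  elim: l => // l IH; have := size_prefix (cS x l).
  by rewrite size_rcons; apply: leq_trans.
have nthc x l l' i : l <= l' -> i < size (c x l) ->
    nth false (c x l') i = nth false (c x l) i.
  by move=> /(cle x) /prefixP[rho ->] lti; rewrite nth_cat lti.
pose a x i := nth false (c x i.+1) i.
have aP x l : ext (c x l) (a x).
  move=> i lti; rewrite /a -(@nthc x l (maxn l i.+1)) ?leq_maxl //.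
  by rewrite -(@nthc x i.+1 (maxn l i.+1)) ?leq_maxr.
exists a => x y xy t; have [j xyj] : exists j, x j <> y j.
  by apply: contrapT => /forallNP H; apply: xy; apply/funext => j; apply: contrapT.
pose l := maxn j (pickle t).
have [_ /(_ (pickle t) (mkseq x l.+1) (mkseq y l.+1) (leq_maxr _ _)
  (size_mkseq _ _) (size_mkseq _ _)) H] := stP (l, S l).
apply: (H _ t (pickleK t) _ _ (aP x l.+1) (aP y l.+1)) => /(congr1 (nth false ^~ j)).
by rewrite !nth_mkseq ?ltnS ?leq_maxl.
Qed.

End Mycielski.

(** * Embedding a power set into an interval *)

Definition embeds_powerset (A B : mass_problem) : Prop :=
  exists D : set (set nat) -> mass_problem,
    (forall S, medvedev_le A (D S) /\ medvedev_le (D S) B) /\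
    forall S S', medvedev_le (D S) (D S') <-> S' `<=` S.

Definition pairs (h z : nat -> baire) : mass_problem :=
  range (fun i => join (h i) (z i)).

Definition maps_pairs B (h z : nat -> baire) (e : code) : Prop :=
  forall i, exists2 y, meet B (pairs h z) y & Phi e (join (h i) (z i)) y.

(** Divergence also counts, since then there is no output [y]. The tag [y 0 = 1] excludes the
    answers coming from [B] in a meet. *)
Definition escapes (h z : nat -> baire) (e : code) (alpha : nat -> bool) : Prop :=
  exists i tau, forall y, Phi e (join (h i) (app tau alpha)) y ->
    y 0 = 1 /\ ~ (pre 1 @` pairs h z) y.

Definition codes_at (y : baire) (l : nat) (alpha : nat -> bool) : Prop :=
  forall n, right_part (tail y) (l + n) = alpha n.

Lemma dense_open_not_codes k e l :
  dense_open [set alpha | forall y, Phi e k y -> ~ codes_at y l alpha].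
Proof.
move=> sigma; have [[y ky]|/forallNP ny] := pselect (exists y, Phi e k y); last first.
  by exists [::] => alpha _ y /ny.
exists [:: right_part (tail y) (l + size sigma) == 0] => alpha sa y' ky' yl.
rewrite -(Phi_det ky ky') in yl; have := yl (size sigma).
rewrite sa ?size_cat ?addn1 // nth_cat ltnn subnn /=.
by case: (right_part _ _).
Qed.

(** Either some extension of [sigma] makes the output at [m] converge, and a bit of [beta] is chosen
    against it, or no [alpha] beyond [sigma] gives a total output. *)
Lemma dense_open2_not_codes f e tau l : dense_open2
  (fun alpha beta => forall y, Phi e (join f (app tau alpha)) y ->
     ~ codes_at y l beta).
Proof.
(* The place, counting the tag, of entry [l + size sigma'] of the right part, where the first free
   bit of [beta] would be copied. *)
move=> sigma sigma'; pose m := (l + size sigma').*2.+2.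
have [[alpha [v [sa ev]]]|none] := pselect (exists alpha v, ext sigma alpha /\
   eval (join f (app tau alpha)) e [:: m] v); last first.
  exists [::], [::] => alpha beta; rewrite cats0 => sa _ y /(_ m) ev _.
  by apply: none; exists alpha, (y m).
have [rho [_ rP]] := eval_use_app sa ev.
exists rho, [:: v == 0] => alpha' beta /rP ev' sb y ky yl.
have := yl (size sigma'); rewrite /right_part /tail -/m.
rewrite -(eval_det ev' (ky m)) sb ?size_cat ?addn1 // nth_cat ltnn subnn /=.
by case: (v).
Qed.

(* For a family of mutually generic [a x], a functional cannot pass from the
   problem built on [S'] to the one built on [S] unless [S'] is a subset of
   [S]: near [join (h i) (z i)] it would have to lead from [a x] with [x] in
   [S'] to some [a x'] with [x'] in [S]. *)
Lemma embeds_powerset_generic A B (h z : nat -> baire) :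
  medvedev_le A B -> medvedev_le A (range h) ->
  comeager [set alpha | forall e, maps_pairs B h z e -> escapes h z e alpha] ->
  embeds_powerset A B.
Proof.
move=> AB Ah [P [dP PQ]].
pose T : countType := (nat + (code * nat * nat) + (code * nat * seq nat * nat))%type.
pose R (t : T) alpha beta := match t with
  | inl (inl n) => P n alpha
  | inl (inr (e, i, l)) => forall y, Phi e (join (h i) (z i)) y -> ~ codes_at y l alpha
  | inr (e, i, tau, l) => forall y, Phi e (join (h i) (app tau alpha)) y ->
     ~ codes_at y l beta
  end.
have dR t : dense_open2 (R t).
  case: t => [[n|[[e i] l]]|[[[e i] tau] l]] sigma sigma' /=.
  - by have [rho H] := dP n sigma; exists rho, [::] => alpha ? /H.
  - have [rho H] := @dense_open_not_codes (join (h i) (z i)) e l sigma.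
    by exists rho, [::] => alpha ? /H.
  - exact: dense_open2_not_codes.
have [a0 a0P] := mycielski dR; pose a (x : set nat) := a0 (fun n => `[<x n>]).
have aP x x' : x <> x' -> forall t, R t (a x) (a x').
  move=> xx'; apply: a0P => E; apply: xx'; apply/funext => n; apply/propext.
  by apply: asbool_eq_equiv; apply: (congr1 (@^~ n) E).
(* [mycielski] speaks of pairs only, so a requirement on a single [a x] is obtained with any second
   index. *)
have aR t x : exists x', R t (a x) (a x').
  have [x'] : exists x', x <> x' :> set nat.
    have [->|] := pselect (x = set0); last by exists set0.
    by exists setT => E; suff : @set0 nat 0 by []; rewrite E.
  by move=> /aP; exists x'.
pose C (S : set (set nat)) : mass_problem := pairs h z `|`
  [set k | exists i tau x, S x /\ k = join (h i) (app tau (a x))].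
have CleftA S : medvedev_le A (C S).
  apply: medvedev_le_trans Ah _; apply: medvedev_le_left => k.
  by case=> [[i _ <-]|[i [tau [x [_ ->]]]]]; rewrite left_join; exists i.
exists (fun S => meet B (C S)); split=> [S|S S'].
  by split; [apply: medvedev_meet_le|apply: medvedev_le_meetl].
split=> [le_SS'|sub]; last first.
  apply: medvedev_le_sub => k [|[f Cf <-]]; first by left.
  right; exists f => //; case: Cf => [pf|[i [tau [x [/sub Sx ->]]]]]; first by left.
  by right; exists i, tau, x.
have /medvedev_leP[e eP] : medvedev_le (meet B (C S)) (C S').
  exact: medvedev_le_trans le_SS' (medvedev_le_meetr _ _).
move=> x S'x; apply: contrapT => nSx.
(* A pair is one fixed oracle over which each [a x'] is generic, so no answer on a pair can contain
   [a x']. *)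
have e_pairs : maps_pairs B h z e.
  move=> i; have [|y Dy ky] := eP (join (h i) (z i)); first by left; exists i.
  exists y => //; case: Dy => [|[f Cf yE]]; first by left.
  case: Cf => [pf|[j [tau [x' [Sx' fE]]]]]; first by right; exists f.
  have [x'' /(_ y ky)] := aR (inl (inr (e, i, size tau))) x'; case=> n.
  by rewrite -yE tail_pre fE right_join app_shift.
have [i [tau esc]] : escapes h z e (a x).
  apply: PQ e_pairs => n; by have [x'] := aR (inl (inl n)) x.
have [|y Dy ky] := eP (join (h i) (app tau (a x))).
  by right; exists i, tau, x.
have [y1 ny] := esc y ky.
case: Dy => [[b _ yE]|[f Cf yE]]; first by rewrite -yE in y1.
case: Cf => [pf|[j [tau' [x' [Sx' fE]]]]]; first by apply: ny; exists f.
have xx' : x <> x' by move=> E; apply: nSx; rewrite E.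
have /(_ y ky) := aP _ _ xx' (inr (e, i, tau, size tau')); case=> n.
by rewrite -yE tail_pre fE right_join app_shift.
Qed.

(** * Antichains and chains of sets of sets *)

(** [F X] holds [X] and its complement on disjoint copies, so an inclusion passes to both and forces
    equality. *)
Lemma antichain_family : exists F : set (set nat) -> set (set nat),
  forall X Y, F X `<=` F Y -> X = Y.
Proof.
pose shift (w : set nat) : set nat := [set n | w n.+1].
pose unshift (p : Prop) (x : set nat) : set nat :=
  [set n | if n is m.+1 then x m else p].
exists (fun X => [set w | w 0 /\ X (shift w) \/ ~ w 0 /\ ~ X (shift w)]).
move=> X Y sub; apply/seteqP; split=> x.
  move=> Xx; have := sub (unshift True x); case=> [|[_ //]|[]]; last by case.
  by left; split.
move=> Yx; apply: contrapT => nXx.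
have := sub (unshift False x); case=> [|[]|[_]] //.
by right; split=> //= -[].
Qed.

Record well_order (lt : set nat -> set nat -> Prop) : Prop := WellOrder {
  wo_least : forall P : set (set nat), P !=set0 ->
    exists2 x, P x & forall y, lt y x -> ~ P y;
  wo_total : forall x y, x <> y -> lt x y \/ lt y x;
  wo_trans : forall x y z, lt x y -> lt y z -> lt x z }.

Lemma well_order_exists : exists lt, well_order lt.
Proof.
have [R Rwo] := wochoice.well_ordering_principle (set nat).
have Rmin (P : set (set nat)) :
    P !=set0 -> exists2 z, P z & forall y, P y -> R z y.
  move=> [x Px]; have [|z [[Pz zmin] _]] := Rwo (fun x => `[< P x >]).
    by exists x; apply/asboolP.
  exists z; first exact/asboolP.
  by move=> y Py; apply: zmin; apply/asboolP.
have Rrefl x : R x x.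
  by have [|z -> Rz] := Rmin [set x]; [exists x|apply: Rz].
have Rtot x y : R x y \/ R y x.
  have [|z [->|->] Rz] := Rmin [set x; y]; first by exists x; left.
    by left; apply: Rz; right.
  by right; apply: Rz; left.
have Ranti x y : R x y -> R y x -> x = y.
  move=> Rxy Ryx; have [|z [_ zP]] := Rwo (fun w => `[< w = x \/ w = y >]).
    by exists x; apply/asboolP; left.
  have zx : z = x.
    by apply: zP; split; [apply/asboolP; left|move=> w /asboolP[]->].
  rewrite -zx; apply: zP.
  by split; [apply/asboolP; right|move=> w /asboolP[]->].
have Rtrans x y z : R x y -> R y z -> R x z.
  move=> Rxy Ryz; have [|w Pw Rw] := Rmin [set w | [\/ w = x, w = y | w = z]].
    by exists x; constructor 1.
  case: Pw Rw => -> Rw.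
  - by apply: Rw; constructor 3.
  - by rewrite (Ranti _ _ Rxy) //; apply: Rw; constructor 1.
  - by rewrite -(Ranti _ _ Ryz) //; apply: Rw; constructor 2.
exists (fun x y => ~ R y x); split.
- by move=> P /Rmin[x Px Rx]; exists x => // y nR /Rx.
- move=> x y xy; apply: contrapT => /not_orP[/contrapT Ryx /contrapT Rxy].
  exact: xy (Ranti _ _ Rxy Ryx).
- move=> x y z nRyx nRzy Rzx; apply: nRzy; apply: Rtrans Rzx _.
  by case: (Rtot x y).
Qed.

(** If some segment is uncountable, take the least such [a0]. By [CH] its segment has the size of
    the continuum, and its order, all of whose segments are countable, is pulled back along
    [phi]. *)
Lemma countable_segments : continuum_hypothesis ->
  exists2 lt, well_order lt & forall a, countable [set b | lt b a].
Proof.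
move=> CH; have [lt ltwo] := well_order_exists.
have [cs|/existsNP ncs] := pselect (forall a, countable [set b | lt b a]).
  by exists lt.
have [a0 na0 mina0] := wo_least ltwo ncs.
have /card_esym : [set b | lt b a0] #= [set: set nat].
  by have [//|] := CH [set b | lt b a0].
rewrite card_eq_le => /andP[/pcard_leP[phi] _].
have phi_inj : injective phi by move=> x y /(inj (f := phi)); apply; rewrite inE.
exists (fun x y => lt (phi x) (phi y)); last first.
  move=> a; have : countable [set b | lt b (phi a)].
    have /mina0 : lt (phi a) a0 by apply: (@funS _ _ _ _ phi a).
    by move/contrapT.
  move=> /countable_injP[i i_inj]; apply/countable_injP; exists (i \o phi).
  by move=> x y /[!inE] xa ya /= /i_inj; rewrite !inE => /(_ xa ya)/phi_inj.
split.
- move=> P [x Px]; have [|_ [y Py <-] ymin] := wo_least ltwo (P := phi @` P).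
    by exists (phi x), x.
  by exists y => // w /ymin nP Pw; apply: nP; exists w.
- by move=> x y xy; apply: wo_total => // /phi_inj.
- by move=> x y z; apply: wo_trans.
Qed.

Section Lexicographic.
Variables (lt : set nat -> set nat -> Prop) (ltwo : well_order lt).

Let ltxx x : ~ lt x x.
Proof.
move=> xx; have [|y -> H] := wo_least ltwo (P := [set x]); first by exists x.
exact: H xx erefl.
Qed.

Definition lexlt (x y : set (set nat)) : Prop :=
  exists2 a, ~ x a /\ y a & forall b, lt b a -> (x b <-> y b).

Lemma lexlt_irrefl x : ~ lexlt x x.
Proof. by move=> [a []]. Qed.

Lemma lexlt_total x y : x <> y -> lexlt x y \/ lexlt y x.
Proof.
move=> xy; have [|a nxya amin] := wo_least ltwo (P := [set a | ~ (x a <-> y a)]).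
  apply: contrapT => /forallNP H; apply: xy; apply/funext => a; apply/propext.
  exact: contrapT (H a).
have agree b : lt b a -> (x b <-> y b) by move=> /amin/contrapT.
have [xa|nxa] := pselect (x a); have [ya|nya] := pselect (y a).
- by case: nxya.
- by right; exists a => // b /agree[].
- by left; exists a.
- by case: nxya; split.
Qed.

Lemma lexlt_trans x y z : lexlt x y -> lexlt y z -> lexlt x z.
Proof.
move=> [a [nxa ya] xy] [b [nyb zb] yz].
have [ab|ab] := pselect (a = b); first by rewrite ab in ya.
have [lt_ab|lt_ba] := wo_total ltwo ab.
  exists a; first by split=> //; apply/(yz a lt_ab).
  by move=> c ca; rewrite xy // yz //; apply: wo_trans lt_ab.
exists b; first by split=> // /(xy b lt_ba).
by move=> c cb; rewrite xy ?yz //; apply: wo_trans lt_ba.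
Qed.

(* Sierpinski's chain: the lexicographic order on the power set of a well order
   has the dense subset of all [a |` s] with [s] bounded by [a], and [x] is
   mapped to the set of elements of this dense subset that are below [x]. *)
Lemma chain_family : (forall a, countable [set b | lt b a]) ->
  exists F : set (set nat) -> set (set nat), forall x y, lexlt x y ->
    F x `<=` F y /\ ~ F y `<=` F x.
Proof.
move=> cseg; have /choice[i iP] : forall a, exists i : set nat -> nat,
    forall b b', lt b a -> lt b' a -> i b = i b' -> b = b'.
  move=> a; have /countable_injP[i i_inj] := cseg a; exists i => b b' ba b'a.
  by apply: i_inj; rewrite inE.
(* The even bits are [a], the odd ones are [s] seen through an injection of the segment below [a]
   into the numbers; thus a bounded set and its bound become one real. *)
pose c a (s : set (set nat)) : set nat :=
  [set n | if odd n then exists2 b, s b & n./2 = i a b else a n./2].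
have c_inj a s a' s' : s `<=` lt^~ a -> s' `<=` lt^~ a' ->
    c a s = c a' s' -> a = a' /\ s = s'.
  move=> sa s'a' E.
  have aa' : a = a'.
    apply/funext => n; have := congr1 (@^~ n.*2) E.
    by rewrite /c /= odd_double doubleK.
  have oddE n : (exists2 b, s b & n = i a b) = (exists2 b, s' b & n = i a' b).
    have := congr1 (@^~ n.*2.+1) E.
    by rewrite /c /= odd_double /= uphalf_double.
  subst a'; split=> //; apply/seteqP; split=> b sb.
    have [b' s'b' /iP->] : exists2 b', s' b' & i a b = i a b'.
      by rewrite -oddE; exists b.
    + by [].
    + exact: sa.
    + exact: s'a'.
  have [b' s'b' /iP->] : exists2 b', s b' & i a b = i a b'.
    by rewrite oddE; exists b.
  + by [].
  + exact: s'a'.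
  + exact: sa.
exists (fun x => [set w | exists a s, [/\ s `<=` lt^~ a, w = c a s &
  a |` s = x \/ lexlt (a |` s) x]]) => x y xy; split.
  move=> w [a [s [sa wE le_x]]]; exists a, s; split=> //; right.
  by case: le_x => [->|/lexlt_trans]; last exact.
(* As [a] is the first difference, adding [a] to [s] gives [y] cut off after [a], which lies above
   [x] but not above [y]. *)
move=> sub; have [a [nxa ya] agree] := xy; pose s := y `&` lt^~ a.
have [|a' [s' [s'a' E le_x]]] := sub (c a s).
  exists a, s; split=> //; first by move=> b [].
  have [E|nE] := pselect (a |` s = y); [by left|right].
  have [//|[b [nyb asb] _]] := lexlt_total nE.
  by case: asb nyb => [->|[yb _]].
have [||aE sE] := c_inj _ _ _ _ _ _ E; [by move=> b []|by []|].
subst a' s'; have lt_x : lexlt x (a |` s).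
  exists a; first by split=> //; left.
  move=> b ba; rewrite agree //; split=> [yb|[bE|[]//]]; first by right.
  by rewrite bE in ba; have := ltxx ba.
case: le_x => [E'|lt_x']; first by rewrite E' in lt_x; apply: lexlt_irrefl lt_x.
exact: lexlt_irrefl (lexlt_trans lt_x lt_x').
Qed.

End Lexicographic.

Lemma big_antichain A B : embeds_powerset A B ->
  contains_big_antichain (degree_of A) (degree_of B).
Proof.
move=> [D [Dint Dle]]; have [F FP] := antichain_family.
pose G X := degree_of (D (F X)).
have GP X Y : (G X <= G Y)%O -> X = Y.
  by move=> /degree_le_of/Dle/FP.
exists (range G); split.
- move=> _ [X _ <-]; have [AD DB] := Dint (F X).
  by apply/andP; split; apply/degree_le_of.
- move=> _ _ [X _ <-] [Y _ <-] nXY; apply/negP => /orP[] /GP E; apply: nXY.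
    by rewrite E.
  by rewrite E.
- by apply: inj_card_eq => X Y _ _ E; apply: GP; rewrite E.
Qed.

Lemma big_chain A B : embeds_powerset A B -> continuum_hypothesis ->
  contains_big_chain (degree_of A) (degree_of B).
Proof.
move=> [D [Dint Dle]] /countable_segments[lt ltwo /(chain_family ltwo)[F FP]].
pose G X := degree_of (D (F X)).
have Glt X Y : lexlt lt X Y -> (G Y < G X)%O.
  move=> /FP[sub nsub]; rewrite lt_leAnge; apply/andP; split.
    exact/degree_le_of/Dle.
  by apply/negP => /degree_le_of/Dle.
exists (range G); split.
- move=> _ [X _ <-]; have [AD DB] := Dint (F X).
  by apply/andP; split; apply/degree_le_of.
- move=> _ _ [X _ <-] [Y _ <-].
  have [->|/(lexlt_total ltwo)[/Glt|/Glt]] := pselect (X = Y).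
  + by constructor 2.
  + by constructor 3.
  + by constructor 1.
- apply: inj_card_eq => X Y _ _ E; apply: contrapT => /(lexlt_total ltwo).
  by case=> /Glt; rewrite E ltxx.
Qed.

(** * Searching through the extensions of a string *)

(* The number whose binary digits are [sigma], then those of [s]. *)
Definition pfx (sigma : seq bool) (s : nat) : nat :=
  foldr (fun (b : bool) p => b + p.*2) s sigma.

Lemma pfx_ext sigma s : ext sigma (bit (pfx sigma s)).
Proof.
elim: sigma => [|b sigma IH] [|i] //= lti.
  by rewrite /bit /= oddD odd_double addbF oddb.
by rewrite -IH // /bit iterSr half_bit_double.
Qed.

Lemma pfx_ge sigma s : s <= pfx sigma s.
Proof.
elim: sigma => //= b sigma IH; apply: leq_trans IH _.
by rewrite -addnn addnA leq_addl.
Qed.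

Lemma computes_pfx n sigma S : computes n S ->
  computes n (fun k xs => pfx sigma (S k xs)).
Proof.
move=> cS; elim: sigma => //= b sigma IH.
apply: computes_add (computes_const _ _) _.
by apply: computes_ext (computes_add IH IH) => k xs _; rewrite addnn.
Qed.

(** Defined on every oracle, so that a search given only [k] can replace the second half of a join
    from place [u] on. *)
Definition graft (k : baire) (u : nat) (alpha : nat -> bool) : baire :=
  fun i => if odd i && (u <= i./2) then alpha (i./2 - u) : nat else k i.

Lemma graft_join f z u alpha :
  graft (join f z) u alpha = join f (app (mkseq z u) alpha).
Proof.
apply/funext => i; rewrite /graft /join /app size_mkseq; case: (odd i) => //=.
by case: leqP => // lti; rewrite nth_mkseq.
Qed.

Lemma graft_low k u alpha i : i < u -> graft k u alpha i = k i.
Proof.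
by move=> ltiu; rewrite /graft leqNgt (leq_ltn_trans (half_le i) ltiu) andbF.
Qed.

Lemma graft_eq k u alpha beta m : (forall i, i < m -> alpha i = beta i) ->
  forall i, i < m -> graft k u alpha i = graft k u beta i.
Proof.
move=> ab i ltim; rewrite /graft; case: ifP => // _; rewrite ab //.
exact: leq_ltn_trans (leq_trans (leq_subr _ _) (half_le i)) ltim.
Qed.

Section Search.
Variables (e : code) (sigma0 : seq bool).

(** One number gives both the string beyond [sigma0] and the step bound, so a single search covers
    the two. *)
Definition searchf (k : baire) (u x s : nat) : nat :=
  stepf (graft k u (bit (pfx sigma0 s))) (pfx sigma0 s) e [:: x].

Lemma computes_searchf n U X S : computes n U -> computes n X -> computes n S ->
  computes n (fun k xs => searchf k (U k xs) (X k xs) (S k xs)).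
Proof.
move=> cU cX cS.
pose O k (ps : seq nat) := graft k (nth 0 ps 0) (bit (nth 0 ps 1)).
have cO : computes 3 (fun k zs => O k (behead zs) (head 0 zs)).
  have ci := @computes_proj 3 0 isT; have cu := @computes_proj 3 1 isT.
  have c := computes_if (computes_andb (computes_odd ci)
    (computes_ltn cu (computes_succ (computes_half ci))))
    (computes_bit (@computes_proj 3 2 isT) (computes_sub (computes_half ci) cu))
    (computes_oracle ci).
  by apply: computes_ext c => k [|i [|u [|p [|]]]].
exact: (computes_stepf e cO (@computes_proj 2 1 isT) cX
  (computes_list_cons cU (computes_list_cons (computes_pfx sigma0 cS)
    (computes_list_nil n)))).
Qed.

(** [rho] depends on [s] alone, so values read at one stage for different [x] belong to one
    extension. *)
Lemma searchf_sound s : exists rho, forall k u x v, searchf k u x s = v.+1 ->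
  forall alpha, ext (sigma0 ++ rho) alpha -> eval (graft k u alpha) e [:: x] v.
Proof.
have [rho [_ rP]] := ext_approx (pfx sigma0 s) (@pfx_ext sigma0 s).
exists rho => k u x v E alpha /rP agree; apply: stepf_sound.
by apply: stepf_mono (leqnn _) _ E; apply: graft_eq.
Qed.

Lemma searchf_complete k u alpha x1 v1 x2 v2 m : ext sigma0 alpha ->
  eval (graft k u alpha) e [:: x1] v1 -> eval (graft k u alpha) e [:: x2] v2 ->
  exists2 s, m <= s & searchf k u x1 s = v1.+1 /\ searchf k u x2 s = v2.+1.
Proof.
move=> sa /stepf_complete[q1 E1] /stepf_complete[q2 E2].
pose q := maxn q1 q2; have [rho [_ rP]] := ext_approx q sa.
(* The digits of [rho] settle the first [q] bits; the number behind them only makes [s] and the step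
   bound large. *)
pose s := pfx rho (maxn m q).
have ps : pfx sigma0 s = pfx (sigma0 ++ rho) (maxn m q) by rewrite /pfx foldr_cat.
have les : maxn m q <= s := pfx_ge _ _.
have leq_s : q <= pfx sigma0 s.
  by apply: leq_trans (leq_trans (leq_maxr m q) les) (pfx_ge _ _).
have agree i : i < q -> graft k u (bit (pfx sigma0 s)) i = graft k u alpha i.
  by apply: graft_eq; apply: rP; rewrite ps; apply: pfx_ext.
exists s; first exact: leq_trans (leq_maxl _ _) les.
by split; apply: (stepf_mono leq_s agree); [apply: E1|apply: E2];
  rewrite ?leq_maxl ?leq_maxr.
Qed.

End Search.

Lemma eval_use_prefix f z e xs v : eval (join f z) e xs v ->
  exists u, forall alpha, eval (join f (app (mkseq z u) alpha)) e xs v.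
Proof.
move=> /eval_use[q qP]; exists q => alpha; rewrite -graft_join.
by apply: qP => x; apply: graft_low.
Qed.

(** * One point of the lower problem with many successors *)

(** Turing reducibility of [g] to [f]. *)
Definition below (g f : baire) : Prop := medvedev_le [set g] [set f].

Lemma computes_nth n tau X : computes n X ->
  computes n (fun k xs => nth 0 tau (X k xs)).
Proof.
elim: tau X => [|t tau IH] X cX.
  by apply: computes_ext (computes_const n 0) => k xs _; rewrite nth_nil.
apply: computes_ext (computes_if (computes_eqn cX (computes_const n 0))
  (computes_const n t) (IH _ (computes_pred cX))) => k xs _.
by case: (X k xs).
Qed.

(* If [y0] could not be avoided beyond [sigma], then any converging computation
   beyond [sigma] would show a correct value of [y0], and a search for such
   computations would compute [y0] from [f]. *)
Lemma dense_open_avoid f tau e y0 : ~ below y0 f ->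
  dense_open [set alpha | ~ Phi e (join f (app tau alpha)) y0].
Proof.
move=> nbelow sigma; apply: contrapT => /forallNP H; apply: nbelow.
have {}H rho : exists2 alpha, ext (sigma ++ rho) alpha &
    Phi e (join f (app tau alpha)) y0.
  have /existsNP[alpha /not_implyP[sa /contrapT P]] := H rho.
  by exists alpha.
pose k := join f (nth 0 tau).
have kE alpha : join f (app tau alpha) = graft k (size tau) alpha.
  rewrite graft_join; congr join; apply/funext => i.
  by rewrite /app size_mkseq; case: ifP => // lti; rewrite nth_mkseq.
have ck : computes 1 (fun k xs => if odd (nth 0 xs 0)
    then nth 0 tau (nth 0 xs 0)./2 else k (nth 0 xs 0)./2).
  have cx := @computes_proj 1 0 isT.
  exact: computes_if (computes_odd cx) (computes_nth tau (computes_half cx))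
    (computes_oracle (computes_half cx)).
have : medvedev_le [set k] [set f].
  by apply: (medvedev_le_total ck) => _ ->.
apply: medvedev_le_trans.
have cT := computes_searchf e sigma (computes_const 2 (size tau))
  (@computes_proj 2 0 isT) (@computes_proj 2 1 isT).
apply: (medvedev_le_search cT) => _ ->; exists y0 => // n /=; split=> [|s v].
  have [alpha] := H [::]; rewrite cats0 => sa ey.
  rewrite kE in ey.
  by have [s _ [E _]] := searchf_complete 0 sa (ey n) (ey n); exists s.
have [rho rP] := searchf_sound e sigma s => /rP ev.
have [alpha /ev + ey] := H rho; rewrite -kE => /eval_det; apply.
exact: ey.
Qed.

Definition proper_joins (f : baire) : mass_problem :=
  [set k | exists2 g, ~ below g f & k = join f g].

Lemma below_right f g y : below (pre 1 (join f g)) y -> below g y.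
Proof.
have cF : computes 1 (fun k xs => k (nth 0 xs 0 + nth 0 xs 0).+2).
  by apply/computes_oracle/computes_succ/computes_succ/computes_add;
    apply: computes_proj.
move=> /(medvedev_le_trans _); apply; apply: (medvedev_le_total cF) => _ -> /=.
by rewrite -[RHS](right_join f g); apply/funext => n; rewrite /right_part addnn.
Qed.

(** Each functional fails to reach [B] on some [join f g], and these [g] make up [z]. Beyond a
    suitable [tau] it answers with tag 1, and a generic [alpha] avoids every [join f (z j)]. *)
Lemma embeds_powerset_point A B f : medvedev_le A B -> medvedev_le A [set f] ->
  ~ medvedev_le B (proper_joins f) -> embeds_powerset A B.
Proof.
move=> AB Af nB.
have /choice[g gP] : forall e, exists g, ~ below g f /\
    forall y, B y -> ~ Phi e (join f g) y.
  move=> e; apply: contrapT => /forallNP H; apply: nB.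
  apply: (medvedev_le_functional (c := e)) => _ [g ng ->].
  apply: contrapT => nex; apply: (H g); split=> // y By ey.
  by apply: nex; exists y.
pose z i := g (odflt CZero (unpickle i)); pose h (i : nat) := f.
have nBp : ~ medvedev_le B (pairs h z).
  move=> /medvedev_leP[e eP].
  have [|y By] := eP (join f (g e)).
    by exists (pickle e) => //; rewrite /z pickleK.
  by have [_] := gP e; apply.
(* Some pair gets an answer with tag 1, and [tau] is a beginning of its [z i] that fixes the tag. *)
have /choice[tau tauP] : forall e, exists tau, maps_pairs B h z e ->
    forall alpha y, Phi e (join f (app tau alpha)) y -> y 0 = 1.
  move=> e; have [me|] := pselect (maps_pairs B h z e); last by exists [::].
  have [i [y iy ey]] : exists i, exists2 y, (pre 1 @` pairs h z) y &
      Phi e (join f (z i)) y.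
    apply: contrapT => /forallNP H; apply: nBp.
    apply: (@medvedev_le_trans _ (pre 0 @` B)).
      by apply: medvedev_le_tail => _ [b Bb <-].
    apply: (medvedev_le_functional (c := e)) => _ [i _ <-].
    have [y [By|py] ey] := me i; first by exists y.
    by case: (H i); exists y.
  have y0 : y 0 = 1 by case: iy => w _ <-.
  have [u uP] := eval_use_prefix (ey 0); exists (mkseq (z i) u) => _ alpha y' ey'.
  by rewrite -(eval_det (uP alpha) (ey' 0)).
apply: (@embeds_powerset_generic _ _ h z) => //.
  by apply: medvedev_le_trans Af _; apply: medvedev_le_sub => _ [i _ <-].
pose P (t : code * nat) alpha :=
  ~ Phi t.1 (join f (app (tau t.1) alpha)) (pre 1 (join f (z t.2))).
have [|R [dR RP]] := @comeager_countable _ P.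
  move=> [e j]; apply: dense_open_avoid => /below_right.
  by have [] := gP (odflt CZero (unpickle j)).
exists R; split=> // alpha /RP Pa e me.
exists 0, (tau e) => y ey; split; first exact: tauP ey.
by move=> [_ [j _ <-] yE]; apply: (Pa (e, j)); rewrite /= yE.
Qed.

(** * Lower problems without finite part *)

Definition finite_part (n : nat) (F : nat -> baire) : mass_problem := F @` `I_n.

Definition first_nz (v : nat -> nat) : nat -> nat :=
  prec_iter 0 (fun t a => if a == 0 then v t else a).

(** A first hit keeps its value at all later stages, so a search may rely on it without
    contradicting itself. *)
Lemma first_nzP v t0 : v t0 != 0 -> exists2 t, v t != 0 &
  (forall s, first_nz v s != 0 -> first_nz v s = v t) /\
  (forall s, t0 < s -> first_nz v s = v t).
Proof.
move=> vt0; have ex : exists t, v t != 0 by exists t0.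
pose t := ex_minn ex; have [vt tmin] : v t != 0 /\
  forall t', v t' != 0 -> t <= t' by rewrite /t; case: ex_minnP.
have low s : s <= t -> first_nz v s = 0.
  elim: s => //= s IH lts; rewrite -/(first_nz v s) IH 1?ltnW //=.
  by apply/eqP; apply: contraTT lts => /tmin; rewrite -leqNgt.
have high s : t < s -> first_nz v s = v t.
  elim: s => // s IH; rewrite ltnS leq_eqVlt => /predU1P[<-|/IH] /=.
    by rewrite -/(first_nz v t) low.
  by rewrite -/(first_nz v s) => ->; rewrite (negbTE vt).
exists t => //; split=> s; last by move=> /(leq_ltn_trans (tmin _ vt0))/high.
by case: (ltnP t s) => [/high//|/low ->].
Qed.

Lemma computes_first_nz n V S : computes n.+2 V -> computes n S ->
  computes n (fun k xs => first_nz (fun t => V k [:: t, 0 & xs]) (S k xs)).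
Proof.
move=> cV cS.
have cV' : computes n.+2 (fun k zs => V k (nth 0 zs 0 :: 0 :: drop 2 zs)).
  apply: computes_args cV _.
  apply: computes_list_cons; first exact: computes_proj.
  apply: computes_list_cons; first exact: computes_const.
  exact/computes_list_drop/computes_list_id.
have c1 := @computes_proj n.+2 1 isT.
apply: computes_ext (computes_prec (computes_const n 0)
  (computes_if (computes_eqn c1 (computes_const n.+2 0)) cV' c1) cS).
by move=> k xs _ /=; rewrite drop0.
Qed.

Section Stuck.
Variables (A B : mass_problem) (e : code) (sigma0 : seq bool).
Variables (n : nat) (G : nat -> baire) (N : nat -> nat).
Let pt i := join (G i) (fun=> N i).

(** Place 2 of [pre 1 (join g (fun=> m))] holds [m 0] in general and the number itself for a
    constant; the bound [b] thus keeps [y] away from all such points with number at least [b]. *)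
Definition hits (F : mass_problem) f tau sigma b : Prop :=
  forall alpha, ext sigma alpha -> forall y, Phi e (join f (app tau alpha)) y ->
    [/\ y 0 = 1, ~ (pre 1 @` F) y & y 2 < b].

Hypothesis N_inj : forall i j, i < n -> j < n -> N i = N j -> i = j.
Hypothesis stuck : forall f tau rho b, A f ->
  ~ hits (finite_part n pt) f tau (sigma0 ++ rho) b.

(** Bound 0 yields some total output. A finite extension freezes its value at place 2, and the
    successor of this value as bound forces an output beyond that extension into the finite part. *)
Lemma stuck_hits f tau : A f ->
  (forall alpha, eval (join f (app tau alpha)) e [:: 0] 1) ->
  forall rho, exists alpha i, [/\ ext (sigma0 ++ rho) alpha, i < n &
    Phi e (join f (app tau alpha)) (pre 1 (pt i))].
Proof.
move=> Af e0 rho; have unhit rho' b : exists alpha y,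
    [/\ ext (sigma0 ++ rho') alpha, Phi e (join f (app tau alpha)) y &
        y 2 < b -> (pre 1 @` finite_part n pt) y].
  have /existsNP[alpha /not_implyP[sa /existsNP[y /not_implyP[ey ny]]]] :=
    stuck (tau := tau) (rho := rho') (b := b) Af.
  exists alpha, y; split=> // lty; apply: contrapT => nF; apply: ny; split=> //.
  by rewrite (eval_det (ey 0) (e0 alpha)).
have [alpha [y [sa ey _]]] := unhit rho 0.
have [rho' [_ rP]] := eval_use_app sa (ey 2).
have [beta [y' [sb ey']]] := unhit (rho ++ rho') (y 2).+1.
rewrite catA in sb; have -> : y' 2 = y 2 := eval_det (ey' 2) (rP _ sb).
move=> /(_ (leqnn _))[_ [i lti <-] yE].
by exists beta, i; split; rewrite ?yE //; apply: ext_catl sb.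
Qed.

(* When no extension of [sigma0] escapes the finitely many [pt i], the first
   converging value at position 2 is some [N i], which identifies [i]; every
   later computation with this value at position 2 then agrees with [pt i]. *)
Lemma stuck_le (K : mass_problem) :
  (forall k, K k -> exists f m, A f /\ k = join f (fun=> m)) ->
  (forall k, K k -> exists2 y, Phi e k y & (pre 0 @` B) y \/ y 0 = 1) ->
  medvedev_le (meet B (finite_part n pt)) K.
Proof.
move=> KA Ke.
(* One more than the least step bound that yields the value at 0, with 0 for not found. This bound
   also bounds the use, so grafting beyond it keeps the value. *)
pose first_step k s := first_nz (fun t =>
  if stepf k t e [:: 0] == 0 then 0 else t.+1) s.
have c_first m S : computes m S -> computes m (fun k xs => first_step k (S k xs)).
  have c0 := computes_const m.+2 0; have ct := @computes_proj m.+2 0 isT.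
  have cV := computes_if (computes_eqn (computes_stepf_self e c0 ct) c0) c0
    (computes_succ ct).
  exact: computes_first_nz cV.
have cs := @computes_proj 2 1 isT; have cx := @computes_proj 2 0 isT.
have c0 := computes_const 2 0.
have cI := c_first _ _ cs; have cu := computes_pred cI.
have cN : computes 2 (fun k xs => first_nz (fun t =>
    searchf e sigma0 k (first_step k (nth 0 xs 1)).-1 2 t) (nth 0 xs 1)).
  have cu' := computes_pred (c_first _ _ (@computes_proj 4 3 isT)).
  have cV := computes_searchf e sigma0 cu' (computes_const 4 2)
    (@computes_proj 4 0 isT).
  by apply: computes_ext (computes_first_nz cV cs) => k xs _.
(* If [stepf] is 1, the tag is 0 and [e] itself is run. Otherwise only stages showing the number
   found first are believed. *)
have cT := computes_if (computes_eqn cI c0) c0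
  (computes_if (computes_eqn (computes_stepf_self e c0 cu) (computes_const 2 1))
    (computes_stepf_self e cx cs)
    (computes_if (computes_eqn cN c0) c0
      (computes_if
        (computes_eqn (computes_searchf e sigma0 cu (computes_const 2 2) cs) cN)
        (computes_searchf e sigma0 cu cx cs) c0))).
apply: (medvedev_le_search cT) => k Kk /=.
have [y ey yP] := Ke _ Kk; have [q0 Eq0] := stepf_complete (ey 0).
pose vI t := if stepf k t e [:: 0] == 0 then 0 else t.+1.
have vI0 : vI q0 != 0 by rewrite /vI Eq0.
have [u vu [I_le I_gt]] := first_nzP vI0.
have Eu : stepf k u e [:: 0] = (y 0).+1.
  move: vu; rewrite /vI; case E: stepf => [|w] //= _.
  by rewrite (eval_det (stepf_sound E) (ey 0)).
have vuE : vI u = u.+1 by rewrite /vI Eu.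
have {}I_le s : first_step k s != 0 -> first_step k s = u.+1.
  by rewrite -vuE; apply: I_le.
have {}I_gt s : q0 < s -> first_step k s = u.+1.
  by rewrite -vuE; apply: I_gt.
have [yB|y1] := yP.
  have y0 : y 0 = 0 by case: yB => b _ <-.
  exists y; first by left.
  move=> x; split=> [|s v].
    have [q1 Eq1] := stepf_complete (ey x); exists (maxn q0.+1 q1).
    by rewrite I_gt ?leq_maxl //= Eu y0 /= Eq1 // leq_maxr.
  case: eqP => // /eqP /I_le ->; rewrite /= Eu y0 /= => E.
  exact: eval_det (stepf_sound E) (ey x).
have [f [m [Af kE]]] := KA _ Kk.
have hit0 := @stuck_hits f (mkseq (fun=> m) u) Af.
have hit : forall rho, exists alpha i, [/\ ext (sigma0 ++ rho) alpha, i < n &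
    Phi e (graft k u alpha) (pre 1 (pt i))].
  move=> rho; have [|alpha [i]] := hit0 _ rho; last first.
    by rewrite -graft_join -kE => H; exists alpha, i.
  move=> alpha; rewrite -graft_join -kE -y1; apply: stepf_sound.
  by apply: stepf_mono (leqnn u) _ Eu => x; apply: graft_low.
have [alpha0 [i0 [sa0 _ ei0]]] := hit [::]; rewrite cats0 in sa0.
have [t0 _ [Et0 _]] := searchf_complete 0 sa0 (ei0 2) (ei0 2).
have vN0 : searchf e sigma0 k u 2 t0 != 0 by rewrite Et0.
have [t vt [N_le N_gt]] := first_nzP vN0.
have [i [lti Et]] : exists i, i < n /\ searchf e sigma0 k u 2 t = (N i).+1.
  case E: searchf vt => [|w] // _; have [rho rP] := searchf_sound e sigma0 t.
  have [alpha [i [sa lti ei]]] := hit rho; exists i; split=> //.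
  by rewrite (eval_det (rP _ _ _ _ E _ sa) (ei 2)).
exists (pre 1 (pt i)); first by right; exists (pt i) => //; exists i.
have uniq_i j : j < n -> pre 1 (pt j) 2 = N i -> j = i.
  by move=> ltj; apply: N_inj.
move=> x; split=> [|s v].
  have [rho rP] := searchf_sound e sigma0 t.
  have [alpha [j [sa ltj ej]]] := hit rho.
  have ji : j = i.
    by apply: uniq_i => //; apply: eval_det (ej 2) (rP _ _ _ _ Et _ sa).
  rewrite ji in ej.
  have [s les [E2 Ex]] := searchf_complete (maxn q0.+1 t0.+1) (ext_catl sa)
    (ej 2) (ej x).
  rewrite geq_max in les; have [leq0 let0] := andP les.
  exists s; rewrite I_gt //= Eu y1 /= (N_gt s) // Et /= E2 Ex.
  by rewrite eqxx.
case: eqP => // /eqP /I_le ->; rewrite /= Eu y1 /=.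
case: eqP => // /eqP /N_le ->; rewrite Et; case: eqP => // E2 Ex.
have [rho rP] := searchf_sound e sigma0 s.
have [alpha [j [sa ltj ej]]] := hit rho.
have ji : j = i.
  by apply: uniq_i => //; apply: eval_det (ej 2) (rP _ _ _ _ E2 _ sa).
by rewrite (eval_det (rP _ _ _ _ Ex _ sa) (ej x)) ji.
Qed.

End Stuck.

(** Dependent choice on whole histories; [ok] is carried along because [R s] need only be solvable
    when all of [s] satisfies it. *)
Lemma history_choice (T : Type) (d : T) (ok : T -> Prop) (R : seq T -> T -> Prop) :
  (forall s, (forall i, i < size s -> ok (nth d s i)) -> exists2 t, ok t & R s t) ->
  exists p : nat -> T, forall m, ok (p m) /\ R (mkseq p m) (p m).
Proof.
move=> H; have /choice[st stP] : forall s, exists t,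
    (forall i, i < size s -> ok (nth d s i)) -> ok t /\ R s t.
  move=> s; have [/H[t okt Rt]|] := pselect (forall i, i < size s -> ok (nth d s i)).
    by exists t.
  by exists d.
pose L := fix L m := if m is m'.+1 then rcons (L m') (st (L m')) else [::].
pose p m := st (L m); have LE m : L m = mkseq p m.
  by elim: m => //= m IH; rewrite mkseqS -IH.
exists p; elim/ltn_ind => m IH; rewrite -LE; apply: stP.
rewrite LE size_mkseq => i lti; rewrite nth_mkseq //.
by have [] := IH i lti.
Qed.

Lemma medvedev_le_join_const (K : mass_problem) m :
  medvedev_le [set k | exists2 g, K g & k = join g (fun=> m)] K.
Proof.
have cx := @computes_proj 1 0 isT.
have cF := computes_if (computes_odd cx) (computes_const 1 m)
  (computes_oracle (computes_half cx)).
by apply: (medvedev_le_total cF) => g Kg; exists g.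
Qed.

(** A stage devoted to [e] and [sigma0] either secures an escape beyond [sigma0] or finds that none
    is possible; the latter is refuted by [stuck_le] once all pairs are known. *)
Lemma embeds_powerset_infinite A B : medvedev_le A B ->
  (forall n F, medvedev_le A (finite_part n F) ->
     ~ medvedev_le (meet B (finite_part n F)) A) ->
  embeds_powerset A B.
Proof.
move=> AB nfin; have [r rP] := inf_often_enum (CZero, None : option (seq bool)).
pose d : baire * nat := (fun=> 0, 0).
pose pt (p : baire * nat) := join p.1 (fun=> p.2).
pose fp s := finite_part (size s) (fun j => pt (nth d s j)).
pose R (s : seq (baire * nat)) (t : baire * nat) :=
  (forall j, j < size s -> (nth d s j).2 < t.2) /\
  match r (size s) with
  | (e, None) => forall y, meet B (fp s) y -> ~ Phi e (pt t) y
  | (e, Some sigma0) =>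
      (exists tau rho, hits e (fp s) t.1 tau (sigma0 ++ rho) t.2) \/
      (forall f tau rho b, A f -> ~ hits e (fp s) f tau (sigma0 ++ rho) b)
  end.
have Afp s : (forall i, i < size s -> A (nth d s i).1) -> medvedev_le A (fp s).
  by move=> As; apply: medvedev_le_left => _ [j ltj <-]; rewrite left_join; apply: As.
(* A constant half is computable, so a functional that worked for all [g] in [A] would put the
   forbidden meet below [A]. *)
have pick e s m : (forall i, i < size s -> A (nth d s i).1) ->
    exists2 g, A g & forall y, meet B (fp s) y -> ~ Phi e (pt (g, m)) y.
  move=> /Afp /nfin nle; apply: contrapT => /forall2NP H; apply: nle.
  apply: medvedev_le_trans (medvedev_le_join_const A m).
  apply: (medvedev_le_functional (c := e)) => _ [g Ag ->].
  apply: contrapT => nex; have [//|nH] := H g; apply: nH => y my ey.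
  by apply: nex; exists y.
have [|p pP] := @history_choice _ d (fun t => A t.1) R.
  move=> s As; have [m mP] : exists m, forall j, j < size s -> (nth d s j).2 < m.
    exists (\max_(j < size s) (nth d s j).2).+1 => j ltj; rewrite ltnS.
    exact: (@leq_bigmax _ (fun j : 'I_(size s) => (nth d s j).2) (Ordinal ltj)).
  rewrite /R; case: (r (size s)) => e [sigma0|]; last first.
    by have [g Ag gP] := pick e s m As; exists (g, m).
  have [[f [tau [rho [b [Af hf]]]]]|nh] := pselect (exists f tau rho b,
      A f /\ hits e (fp s) f tau (sigma0 ++ rho) b).
    (* With a number at least [b] here and larger ones later, the outputs of this hit differ from
       all pairs still to come. *)
    exists (f, maxn m b) => //; split=> [j /mP ltj|] /=.
      exact: leq_trans (leq_maxl _ _).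
    left; exists tau, rho => alpha sa y /(hf _ sa)[y0 ny ltb]; split=> //.
    exact: leq_trans (leq_maxr _ _).
  have [g Ag _] := pick CZero s m As; exists (g, m) => //; split=> //; right.
  by move=> f tau rho b Af hf; apply: nh; exists f, tau, rho, b.
have fpE m : fp (mkseq p m) = finite_part m (pt \o p).
  by rewrite /fp size_mkseq; apply: eq_imagel => j ltj; rewrite nth_mkseq.
pose h m := (p m).1; pose z m : baire := fun=> (p m).2.
have p_lt i j : i < j -> (p i).2 < (p j).2.
  move=> ltij; have [_ [/(_ i) + _]] := pP j.
  by rewrite size_mkseq nth_mkseq //; apply.
have nle m : ~ medvedev_le (meet B (finite_part m (pt \o p))) (pairs h z).
  (* A stage [m'] not before [m] is needed, so that the finite set in question is part of its
     history. *)
  move=> /medvedev_leP[e eP]; have [m' lem rm'] := rP (e, None) m.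
  have [|y By ey] := eP (pt (p m')); first by exists m'.
  have [_ [_]] := pP m'; rewrite size_mkseq rm' fpE => /(_ y); apply=> //.
  case: By => [|[_ [j ltj <-] <-]]; [by left|right; exists (pt (p j)) => //].
  by exists j => //; apply: leq_trans lem.
apply: (@embeds_powerset_generic _ _ h z) => //.
  by apply: medvedev_le_sub => _ [m _ <-]; have [] := pP m.
apply: comeager_countable => e sigma0.
have [me|nme] := pselect (maps_pairs B h z e); last by exists [::].
have [m _ rm] := rP (e, Some sigma0) 0.
have [_ [_]] := pP m; rewrite size_mkseq rm fpE => -[[tau [rho hit]]|stuck].
  exists rho => alpha sa _; exists m, tau => y /(hit _ sa)[y0 ny lty]; split=> //.
  move=> [_ [j _ <-] yE]; have [ltjm|lemj] := ltnP j m.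
    by apply: ny; exists (pt (p j)) => //; exists j.
  move: lty; rewrite -yE /= ltnNge leq_eqVlt; case/negP.
  by move: lemj; rewrite leq_eqVlt => /predU1P[->|/p_lt ->]; rewrite ?eqxx ?orbT.
case: (nle m); apply: (stuck_le (A := A) (e := e) (sigma0 := sigma0)) => //.
- move=> i j ltim ltjm E.
  by case: (ltngtP i j) => // /p_lt; rewrite /= E ltnn.
- by move=> _ [i _ <-]; exists (h i), (p i).2; split=> //; have [] := pP i.
- move=> _ [i _ <-]; have [y [By|[w _ <-]] ey] := me i.
    by exists y => //; left.
  by exists (pre 1 w) => //; right.
Qed.

(** * The Boolean case *)

(** Where two candidates differ, the output at that place discards one of them and
    [medvedev_le_branch] merges the two cases; if all candidates agree, one hypothesis suffices. *)
Lemma medvedev_le_finite (D K : mass_problem) d n F :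
  (forall k, K k -> exists2 i, i < n & Phi d k (F i)) ->
  (forall i, i < n -> medvedev_le D [set k | K k /\ Phi d k (F i)]) ->
  medvedev_le D K.
Proof.
suff main (l : seq nat) : (forall k, K k -> exists2 i, i \in l & Phi d k (F i)) ->
    (forall i, i \in l -> medvedev_le D [set k | K k /\ Phi d k (F i)]) ->
    medvedev_le D K.
  move=> KF DK; apply: (main (iota 0 n)) => [k /KF[i lti ki]|i].
    by exists i; rewrite ?mem_iota.
  by rewrite mem_iota; apply: DK.
have [m] := ubnP (size l); elim: m => // m IH in l K *; rewrite ltnS => szl KF DK.
case: l => [|i0 l] in szl KF DK *.
  by apply: medvedev_le_sub => k /KF[].
have [same|] := pselect (forall j, j \in i0 :: l -> F j = F i0).
  apply: medvedev_le_trans (DK i0 (mem_head _ _)) _.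
  by apply: medvedev_le_sub => k Kk; have [j /same <-] := KF k Kk.
move=> /existsNP[j /not_implyP[jl Fj]].
have [x Fx] : exists x, F j x <> F i0 x.
  by apply: contrapT => /forallNP H; apply: Fj; apply/funext => x; apply: contrapT.
have smaller (a : pred nat) i : i \in i0 :: l -> ~~ a i ->
    size (filter a (i0 :: l)) < m.
  move=> il nai; apply: leq_trans szl; rewrite size_filter -(count_predC a) -addn1.
  by rewrite leq_add2l -has_count; apply/hasP; exists i.
have sub (K' : mass_problem) i : K' `<=` K -> i \in i0 :: l ->
    medvedev_le D [set k | K' k /\ Phi d k (F i)].
  move=> K'K /DK DKi; apply: medvedev_le_trans DKi _.
  by apply: medvedev_le_sub => k [/K'K].
apply: (@medvedev_le_branch _ _ d x (F i0 x)).
- by move=> k /KF[i _]; exists (F i).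
- apply: (IH [seq i <- i0 :: l | F i x == F i0 x]).
  + by apply: smaller jl _; apply/eqP.
  + move=> k [/KF[i il ki] /(_ _ ki) Fi]; exists i => //.
    by rewrite mem_filter il Fi eqxx.
  + by move=> i; rewrite mem_filter => /andP[_]; apply: sub => k [].
- apply: (IH [seq i <- i0 :: l | F i x != F i0 x]).
  + by apply: (smaller _ i0); rewrite ?mem_head //= eqxx.
  + move=> k [/KF[i il ki] /(_ _ ki)/eqP Fi]; exists i => //.
    by rewrite mem_filter il andbT.
  + by move=> i; rewrite mem_filter => /andP[_]; apply: sub => k [].
Qed.

Lemma finite_part_le D n F :
  (forall i, i < n -> medvedev_le D [set F i]) -> medvedev_le D (finite_part n F).
Proof.
move=> DF; apply: (@medvedev_le_finite _ _ COracle n F).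
  by move=> _ [i lti <-]; exists i => //; apply: Phi_oracle.
move=> i /DF /medvedev_le_trans; apply.
by apply: medvedev_le_sub => k [_ /(Phi_det (Phi_oracle k))].
Qed.

Section Boolean.
Variables (A B : mass_problem) (n : nat) (F : nat -> baire).
Hypothesis AB : medvedev_le A B.
Hypothesis AF : medvedev_le A (finite_part n F).
Hypothesis FA : medvedev_le (meet B (finite_part n F)) A.
Hypothesis indep : forall i, i < n ->
  ~ medvedev_le (meet B (F @` [set j | j < n /\ j <> i])) [set F i].
Hypothesis BF : forall i, i < n -> medvedev_le B (proper_joins (F i)).

(** Points outside [X] are kept, because fewer points make the meet with [B] higher. *)
Let rest (X : {set 'I_n}) : mass_problem :=
  [set k | exists2 i : 'I_n, i \notin X & k = F i].

Let A_rest X : medvedev_le A (rest X).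
Proof.
apply: medvedev_le_trans AF _; apply: medvedev_le_sub => _ [i _ ->].
by exists (val i) => //=.
Qed.

Let rest_mono X Y : medvedev_le (meet B (rest X)) (meet B (rest Y)) -> X \subset Y.
Proof.
move=> le_XY; apply/fintype.subsetP => i iX; apply: contrapT => /negP niY.
apply: (indep (ltn_ord i)).
apply: (@medvedev_le_trans _ (meet B (rest X))).
  apply: medvedev_le_sub => k [|[_ [j njX ->] <-]]; [by left|right].
  exists (F j) => //; exists (val j) => //; split=> [|/val_inj ji]; first exact: ltn_ord.
  by rewrite ji iX in njX.
apply: medvedev_le_trans le_XY _; apply: medvedev_le_trans (medvedev_le_meetr _ _) _.
by apply: medvedev_le_sub => _ ->; exists i.
Qed.

(* A point of [C] computes either an element of [B] or some [F i].  In the second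
   case, if [C] has no point below [F i], it also computes an element of [B]. *)
Let rest_surj C : medvedev_le A C -> medvedev_le C B -> exists X,
  medvedev_le (meet B (rest X)) C /\ medvedev_le C (meet B (rest X)).
Proof.
move=> AC CB; pose X := finset (fun i : 'I_n => ~~ `[< medvedev_le C [set F i] >]).
exists X; split; last first.
  apply: medvedev_meet_le => //.
  apply: (@medvedev_le_finite _ _ COracle n F).
    by move=> _ [i _ ->]; exists i => //; apply: Phi_oracle.
  move=> i lti; have [CF|nCF] := pselect (medvedev_le C [set F i]).
    apply: medvedev_le_trans CF _.
    by apply: medvedev_le_sub => k [_ /(Phi_det (Phi_oracle k))].
  apply: medvedev_le_sub => k [[j njX ->]].
  move=> /(Phi_det (Phi_oracle _)) Fji; case: nCF; rewrite -Fji.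
  by move: njX; rewrite inE negbK => /asboolP.
have /medvedev_leP[e eP] := medvedev_le_trans FA AC.
apply: (@medvedev_le_branch _ _ e 0 0).
- by move=> k /eP[y _]; exists y.
- apply: (medvedev_le_functional (c := e)) => k [/eP[y yF ey] /(_ _ ey) y0].
  by exists y => //; case: yF => [|[w _ yE]]; [left|rewrite -yE in y0].
apply: (@medvedev_le_finite _ _ e n (fun i => pre 1 (F i))).
  move=> k [/eP[y yF ey] /(_ _ ey) y0]; case: yF => [[w _ yE]|[_ [i lti <-] yE]].
    by rewrite -yE in y0.
  by exists i => //; rewrite yE.
move=> i lti; have [CF|nCF] := pselect (medvedev_le C [set F i]).
  apply: (medvedev_le_functional (c := e)) => k [_ ek].
  exists (pre 1 (F i)) => //; right; exists (F i) => //.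
  by exists (Ordinal lti) => //; rewrite inE negbK; apply/asboolP.
(* No [k] in [C] is below [F i], so [join (F i) k] is a proper join; [k] computes it through [e],
   and hence an element of [B]. *)
apply: medvedev_le_trans (medvedev_le_meetl _ _) _.
apply: medvedev_le_trans (BF lti) _.
have cx := @computes_proj 2 0 isT.
have cT := computes_if (computes_odd cx)
  (computes_succ (computes_oracle (computes_half cx)))
  (computes_stepf_self e (computes_succ (computes_half cx)) (@computes_proj 2 1 isT)).
apply: (medvedev_le_search cT) => k [[Ck _] ek]; exists (join (F i) k).
  exists k => // bk; apply: nCF; apply: medvedev_le_trans bk.
  by apply: medvedev_le_sub => _ ->.
move=> x /=; rewrite /join; case: (odd x); first by split=> [|s v [<-]]; first by exists 0.
split=> [|s v /stepf_sound E]; last exact: eval_det E (ek _).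
by have [q qP] := stepf_complete (ek (x./2).+1); exists q; rewrite qP.
Qed.

Lemma boolean_interval :
  isomorphic_to_powerset n (order_interval (degree_of A) (degree_of B)).
Proof.
pose f X := degree_of (meet B (rest X)).
have f_mono : {mono f : X Y / X \subset Y >-> (X <= Y)%O}.
  move=> X Y; apply/idP/idP => [/degree_le_of/rest_mono//|/fintype.subsetP XY].
  apply/degree_le_of/medvedev_le_sub => k [|[_ [i niY ->] <-]]; [by left|right].
  by exists (F i) => //; exists i => //; apply: contra niY; apply: XY.
exists f; split=> //; split.
- move=> X _; apply/andP; split; apply/degree_le_of; last exact: medvedev_le_meetl.
  exact: medvedev_meet_le AB (A_rest X).
- move=> X Y _ _ E; apply/eqP.
  by rewrite finset.eqEsubset -!f_mono E lexx.
- move=> c; have [C <-] := degree_of_surj c => /andP[/degree_le_of AC /degree_le_of CB].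
  by have [X XP] := rest_surj AC CB; exists X => //; apply/degree_ofP.
Qed.

End Boolean.

(** * The dichotomy *)

Lemma embeds_powerset_or_boolean A B : medvedev_le A B -> ~ medvedev_le B A ->
  embeds_powerset A B \/ exists n, 1 <= n /\
    isomorphic_to_powerset n (order_interval (degree_of A) (degree_of B)).
Proof.
move=> AB nBA; pose fin n := `[< exists2 F, medvedev_le A (finite_part n F) &
  medvedev_le (meet B (finite_part n F)) A >].
have [[n0 fin0]|/forallNP nfin] := pselect (exists n, fin n); last first.
  left; apply: embeds_powerset_infinite => // n F AF FA.
  by apply: (nfin n); apply/asboolP; exists F.
have [|n finn nmin] := @ex_minnP fin; first by exists n0.
have [F AF FA] := asboolP _ finn.
have [BF|/existsNP[i /not_implyP[lti nBF]]] :=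
    pselect (forall i, i < n -> medvedev_le B (proper_joins (F i))); last first.
  left; apply: (embeds_powerset_point AB _ nBF).
  apply: medvedev_le_trans AF _.
  by apply: medvedev_le_sub => _ ->; exists i.
right; exists n; split.
  (* Without points, the meet is equivalent to [B], which would then be below [A]. *)
  rewrite lt0n; apply/eqP => n0E; apply: nBA; apply: medvedev_le_trans FA.
  apply: medvedev_meet_le; first exact: medvedev_le_refl.
  by apply: medvedev_le_sub => k [i]; rewrite n0E.
(* Independence comes from minimality: a redundant [F i] could be dropped, with [bump i] enumerating
   the other indices. *)
apply: (boolean_interval AB AF FA _ BF) => i lti le_i.
case: n => // n in finn nmin AF FA BF lti le_i *.
have /nmin : fin n; last by rewrite ltnn.
have bumpF : finite_part n (F \o bump i) = F @` [set j | j < n.+1 /\ j <> i].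
  apply/seteqP; split=> [_ [j ltj <-]|_ [j [ltj /eqP nji] <-]] /=.
    exists (bump i j) => //; split.
      by rewrite /bump; case: (i <= j) => //=; rewrite add0n; apply: leqW.
    by apply/eqP; rewrite eq_sym neq_bump.
  exists (unbump i j); last by rewrite /= unbumpKcond (negbTE nji).
  rewrite /= /unbump; case: (ltnP i j) => lij /=.
    by case: j ltj lij nji => //= j; rewrite subn1.
  have ltji : j < i by rewrite ltn_neqAle nji.
  by rewrite subn0; apply: leq_trans ltji _; rewrite -ltnS.
apply/asboolP; exists (F \o bump i); rewrite bumpF.
  apply: medvedev_le_trans AF _.
  by apply: medvedev_le_sub => _ [j [ltj _] <-]; exists j.
apply: medvedev_le_trans FA.
apply: medvedev_meet_le (medvedev_le_meetl _ _) _.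
apply: finite_part_le => j ltj; have [->//|/eqP nji] := eqVneq j i.
apply: medvedev_le_trans (medvedev_le_meetr _ _) _.
by apply: medvedev_le_sub => _ ->; exists j.
Qed.

(** The interval is finite. This makes the claim about chains vacuous in the Boolean case. *)
Lemma powerset_not_big_antichain n (A B : medvedev_degree) :
  isomorphic_to_powerset n (order_interval A B) -> ~ contains_big_antichain A B.
Proof.
move=> [f [[_ _ surj] _]] [S [Sint _ Scard]].
have finS : finite_set S.
  apply: sub_finite_set (fun x Sx => surj x (Sint x Sx)) _.
  exact: finite_image.
have fin22 : finite_set [set: set (set nat)].
  by rewrite -(eq_finite_set Scard).
apply: infinite_nat; pose i (m : nat) : set (set nat) := [set [set m]].
have i_inj : injective i.
  move=> m m' E; have : i m [set m] by [].
  rewrite E => E'; have : [set m] m by [].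
  by rewrite E'.
have fin_range : finite_set (range i) by apply: sub_finite_set fin22.
rewrite -(eq_finite_set (A := range i)) //.
by apply: inj_card_eq => m m' _ _ /i_inj.
Qed.

Theorem theorem4p3 (A B : medvedev_degree) (hAB : (A < B)%O) :
  ((exists n : nat, (1 <= n)%N /\
      isomorphic_to_powerset n (order_interval A B))
   \/ contains_big_antichain A B)
  /\ (contains_big_antichain A B -> continuum_hypothesis ->
      contains_big_chain A B).
Proof.
have [a aE] := degree_of_surj A; have [b bE] := degree_of_surj B.
move: hAB; rewrite -aE -bE lt_leAnge => /andP[/degree_le_of ab /negP nba].
have {}nba : ~ medvedev_le b a by move=> /degree_le_of.
have [emb|[n [n1 iso]]] := embeds_powerset_or_boolean ab nba.
  by split=> [|_]; [right; apply: big_antichain|apply: big_chain].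
split; first by left; exists n.
by move=> /(powerset_not_big_antichain iso).
Qed.
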